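(* Let $n\ge2$ be even and let $(M^n,g)=(\mathbb{R}^n,e^{2w}|dx|^2)$, where $$w(x)=\frac{1}{c_n}\int_{\mathbb{R}^n}\log\frac{|y|}{|x-y|}\,P(y)\,dy+C$$ for some constant $C$ and some continuous function $P\in L^1(\mathbb{R}^n)$ with $\int_{\mathbb{R}^n}P(x)\,dx<c_n$. Then $e^{nw}$ is a strong $A_\infty$ weight on $\mathbb{R}^n$.
   Context: The constant $c_n>0$ is the one in the fundamental solution equation $(-\Delta)^{n/2}\log\frac{1}{|x|}=c_n\delta_0$ on $\mathbb{R}^n$, where $\Delta=\sum_i\partial_i^2$ (for example $c_2=2\pi$, $c_4=8\pi^2$). A positive locally integrable function $\omega$ on $\mathbb{R}^n$ is an $A_\infty$ weight if for each $\epsilon>0$ there is $\delta>0$ such that whenever $Q\subseteq\mathbb{R}^n$ is a cube and $E\subseteq Q$ satisfies $|E|\le\delta|Q|$, then $\omega(E)\le\epsilon\,\omega(Q)$; here $|E|$ is Lebesgue measure and $\omega(E)=\int_E\omega\,dx$. For a rectifiable arc $\gamma$, its $\omega$-length is $\int_\gamma\omega^{1/n}\,|ds|$, with $|ds|$ Euclidean arc length. Set $d_\omega(x,y)=\inf_\gamma(\omega\text{-length of }\gamma)$ over rectifiable $\gamma$ connecting $x$ and $y$, and $\delta(x,y)=\left(\int_{B_{x,y}}\omega(z)\,dz\right)^{1/n}$, where $B_{x,y}$ is the ball of diameter $|x-y|$ containing $x$ and $y$. An $A_\infty$ weight $\omega$ satisfies $d_\omega(x,y)\le C\delta(x,y)$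 for all $x,y$. It is called a strong $A_\infty$ weight if in addition there is a constant $C$ with $\delta(x,y)\le C\,d_\omega(x,y)$ for all $x,y\in\mathbb{R}^n$. *)

(* Defs.v *)
From HB Require Import structures.
From mathcomp Require Import all_boot all_order all_algebra.
From mathcomp Require Import all_classical all_reals all_analysis.

Set Implicit Arguments.
Unset Strict Implicit.
Unset Printing Implicit Defensive.

Import Order.TTheory GRing.Theory Num.Theory.
Import numFieldNormedType.Exports.

Local Open Scope classical_set_scope.
Local Open Scope ring_scope.

(* R^n is the normed space 'rV[R]_n; the library gives it the product
   topology and the sup norm, so the Euclidean norm is defined separately
   (it induces the same topology). *)
Definition enorm (R : realType) (n : nat) (x : 'rV[R]_n) : R :=
  Num.sqrt (\sum_(i < n) x ord0 i ^+ 2).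

(* 'rV[R]_n with the sigma-algebra generated by the coordinates, which is its
   Borel sigma-algebra; same construction as for n.-tuple R. *)
Section measurable_rV.
Variables (R : realType) (n : nat).

Let coors : 'I_n -> 'rV[R]_n -> measurableTypeR R := fun i x => x ord0 i.

Let rV_set0 : g_sigma_preimage coors set0.
Proof. exact: sigma_algebra0. Qed.

Let rV_setC A : g_sigma_preimage coors A -> g_sigma_preimage coors (~` A).
Proof. exact: sigma_algebraC. Qed.

Let rV_bigcup (F : (set 'rV[R]_n)^nat) :
  (forall i, g_sigma_preimage coors (F i)) ->
  g_sigma_preimage coors (\bigcup_i (F i)).
Proof. exact: sigma_algebra_bigcup. Qed.

HB.instance Definition _ := @isMeasurable.Build default_measure_display
  'rV[R]_n (g_sigma_preimage coors) rV_set0 rV_setC rV_bigcup.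

End measurable_rV.

Section rV_cons.
Variable R : realType.

Definition rV_cons (n : nat) (p : measurableTypeR R * 'rV[R]_n) : 'rV[R]_n.+1 :=
  row_mx (const_mx p.1 : 'rV[R]_1) p.2.

Lemma rV_cons0 (n : nat) (p : measurableTypeR R * 'rV[R]_n) :
  rV_cons p ord0 ord0 = p.1.
Proof.
transitivity (row_mx (const_mx p.1 : 'rV[R]_1) p.2 ord0 (lshift n ord0)).
  by rewrite /rV_cons; congr (fun_of_matrix _ _ _); exact: val_inj.
by rewrite row_mxEl mxE.
Qed.

Lemma rV_consS (n : nat) (p : measurableTypeR R * 'rV[R]_n) (j : 'I_n) :
  rV_cons p ord0 (lift ord0 j) = p.2 ord0 j.
Proof.
rewrite -(row_mxEr (const_mx p.1 : 'rV[R]_1) p.2 ord0 j).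
by rewrite /rV_cons; congr (fun_of_matrix _ _ _); exact: val_inj.
Qed.

Lemma measurable_coord (n : nat) (i : 'I_n) :
  measurable_fun [set: 'rV[R]_n]
    (fun x : 'rV[R]_n => x ord0 i : measurableTypeR R).
Proof.
move=> _ Y mY; rewrite setTI; apply: sub_sigma_algebra => /=.
rewrite -bigcup_seq/=; exists i => /=; first by rewrite mem_index_enum.
by exists Y => //; rewrite setTI.
Qed.

Lemma measurable_rV_cons (n : nat) : measurable_fun setT (@rV_cons n).
Proof.
move=> _ A mA; rewrite setTI; move: A mA.
apply: (@smallest_sub _ (sigma_algebra setT) _
  [set A | measurable (@rV_cons n @^-1` A)]).
  split => /=.
  - by rewrite preimage_set0.
  - by move=> B mB; rewrite setTD preimage_setC; exact: measurableC.
  - by move=> F mF; rewrite preimage_bigcup; exact: bigcupT_measurable.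
move=> B; rewrite -bigcup_seq => -[i _] [D mD <-] /=.
rewrite setTI.
have [j ->|->] := unliftP ord0 i.
- have -> : @rV_cons n @^-1` ((fun x : 'rV[R]_n.+1 => x ord0 (lift ord0 j)) @^-1` D)
          = setT `&` ((fun x : 'rV[R]_n => x ord0 j : measurableTypeR R) \o snd) @^-1` D.
    by rewrite setTI; apply/seteqP; split => p /=; rewrite rV_consS.
  have mc : measurable_fun setT
     ((fun x : 'rV[R]_n => x ord0 j : measurableTypeR R) \o
        @snd (measurableTypeR R) 'rV[R]_n).
    by apply: measurableT_comp => //; exact: measurable_coord.
  exact: mc.
- have -> : @rV_cons n @^-1` ((fun x : 'rV[R]_n.+1 => x ord0 ord0) @^-1` D)
          = setT `&` fst @^-1` D.
    by rewrite setTI; apply/seteqP; split => p /=; rewrite rV_cons0.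
  exact: measurable_fst.
Qed.

End rV_cons.

Section lebesgue_rV_step.
Variables (R : realType) (n : nat).
Variable mu : {sigma_finite_measure set 'rV[R]_n -> \bar R}.
Local Open Scope ereal_scope.

Definition lebesgue_rV_step : set 'rV[R]_n.+1 -> \bar R :=
  pushforward (lebesgue_measure \x mu) (@rV_cons R n).

Let step0 : lebesgue_rV_step set0 = 0.
Proof. by rewrite /lebesgue_rV_step /pushforward preimage_set0 measure0. Qed.

Let step_ge0 A : 0 <= lebesgue_rV_step A.
Proof. by rewrite /lebesgue_rV_step /pushforward; exact: measure_ge0. Qed.

Let step_sigma_additive : semi_sigma_additive lebesgue_rV_step.
Proof.
move=> F mF tF mUF; rewrite /lebesgue_rV_step /pushforward preimage_bigcup.
apply: measure_semi_sigma_additive.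
- by move=> k; rewrite -[X in measurable X]setTI; exact: measurable_rV_cons.
- apply/trivIsetP => /= i j _ _ ij; rewrite -preimage_setI.
  by move/trivIsetP : tF => /(_ _ _ _ _ ij) ->//; rewrite preimage_set0.
- rewrite -preimage_bigcup -[X in measurable X]setTI.
  exact: measurable_rV_cons.
Qed.

HB.instance Definition _ := isMeasure.Build _ _ _
  lebesgue_rV_step step0 step_ge0 step_sigma_additive.

Let step_sigma_finite : sigma_finite setT lebesgue_rV_step.
Proof.
have /sigma_finiteP[F [TF ndF Foo]] := sigma_finiteT (@lebesgue_measure R).
have /sigma_finiteP[G [TG ndG Goo]] := sigma_finiteT mu.
pose c0 (x : 'rV[R]_n.+1) : measurableTypeR R := x ord0 ord0.
pose c1 (x : 'rV[R]_n.+1) : 'rV[R]_n := \row_j x ord0 (lift ord0 j).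
have mc1 : measurable_fun setT c1.
  move=> _ A mA; rewrite setTI; move: A mA.
  apply: (@smallest_sub _ (sigma_algebra setT) _
    [set A | measurable (c1 @^-1` A)]).
    split => /=.
    - by rewrite preimage_set0.
    - by move=> B mB; rewrite setTD preimage_setC; exact: measurableC.
    - by move=> H mH; rewrite preimage_bigcup; exact: bigcupT_measurable.
  move=> B; rewrite -bigcup_seq => -[i _] [D mD <-] /=; rewrite setTI.
  have -> : c1 @^-1` ((fun x : 'rV[R]_n => x ord0 i) @^-1` D) =
      setT `&` (fun x : 'rV[R]_n.+1 => x ord0 (lift ord0 i)) @^-1` D.
    by rewrite setTI; apply/seteqP; split => x /=; rewrite /c1 mxE.
  exact: measurable_coord.
have c0K p : c0 (rV_cons p) = p.1 by exact: rV_cons0.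
have c1K p : c1 (rV_cons p) = p.2.
  by apply/rowP => j; rewrite /c1 mxE rV_consS.
exists (fun k => c0 @^-1` F k `&` c1 @^-1` G k).
  apply/esym; rewrite -subTset => x _.
  have [k _ Fk] : (\bigcup_k F k) (c0 x) by rewrite -TF.
  have [l _ Gl] : (\bigcup_k G k) (c1 x) by rewrite -TG.
  exists (maxn k l) => //; split.
  - by have /subsetPset FS := ndF _ _ (leq_maxl k l); exact: FS.
  - by have /subsetPset GS := ndG _ _ (leq_maxr k l); exact: GS.
move=> k; have [mF Fk] := Foo k; have [mG Gk] := Goo k.
split.
  apply: measurableI; rewrite -[X in measurable X]setTI.
  - exact: measurable_coord.
  - exact: mc1.
rewrite /lebesgue_rV_step /pushforward.
have -> : @rV_cons R n @^-1` (c0 @^-1` F k `&` c1 @^-1` G k) = F k `*` G k.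
  by apply/seteqP; split => p /=; rewrite c0K c1K.
by rewrite product_measure1E// lte_mul_pinfty// ge0_fin_numE.
Qed.

HB.instance Definition _ := Measure_isSigmaFinite.Build _ _ _
  lebesgue_rV_step step_sigma_finite.

End lebesgue_rV_step.

(* Lebesgue measure on R^n, as the iterated product of the one-dimensional
   Lebesgue measure (the unit mass on the one-point space R^0). *)
Fixpoint lebesgue_rV (R : realType) (n : nat) :
    {sigma_finite_measure set 'rV[R]_n -> \bar R} :=
  match n with
  | 0 => dirac (0 : 'rV[R]_0)
  | k.+1 => lebesgue_rV_step (lebesgue_rV R k)
  end.

Lemma lebesgue_rV_box (R : realType) (n : nat) (A : 'I_n -> set (measurableTypeR R)) :
  (forall i, measurable (A i)) ->
  (lebesgue_rV R n [set x | forall i, A i (x ord0 i)] =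
   \prod_(i < n) lebesgue_measure (A i))%E.
Proof.
elim: n A => [|n IH] A mA.
  rewrite big_ord0 /= diracE (_ : (0 : 'rV[R]_0) \in _ = true) //.
  by apply: mem_set => -[].
have mB : measurable [set x : 'rV[R]_n | forall i, A (lift ord0 i) (x ord0 i)].
  rewrite (_ : [set x | _] = \bigcap_(i in [set` index_enum 'I_n])
      (fun x : 'rV[R]_n => x ord0 i : measurableTypeR R) @^-1` A (lift ord0 i)).
    rewrite bigcap_seq; apply: bigsetI_measurable => i _.
    by rewrite -[X in measurable X]setTI; exact: measurable_coord.
  by apply/seteqP; split=> x Ax i //=; apply: Ax => /=; exact: mem_index_enum.
rewrite big_ord_recl -IH //= /lebesgue_rV_step /pushforward.
rewrite -product_measure1E //; congr (_ _).
apply/seteqP; split => p /=.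
  by move=> Ap; split => [|i] /=; rewrite -?rV_cons0 -?rV_consS.
move=> [A0 AS] i; case: (unliftP ord0 i) => [j ->|->].
  by rewrite rV_consS.
by rewrite rV_cons0.
Qed.

Section smooth_functions.
Variables (R : realType) (n : nat).
Implicit Types (f : 'rV[R]_n -> R) (s : seq 'I_n).

Definition partial (i : 'I_n) f : 'rV[R]_n -> R :=
  fun x => 'D_(delta_mx ord0 i) f x.

Definition partials s f : 'rV[R]_n -> R := foldr partial f s.

Definition smooth f : Prop :=
  forall s, continuous (partials s f) /\
    forall i x, derivable (partials s f) x (delta_mx ord0 i).

Definition test_function f : Prop :=
  smooth f /\ compact (closure [set x | f x != 0]).

Definition laplacian f : 'rV[R]_n -> R :=
  fun x => \sum_(i < n) partial i (partial i f) x.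

Definition neg_laplacian_iter (k : nat) f : 'rV[R]_n -> R :=
  iter k (fun g x => - laplacian g x) f.

(* For even n: c > 0 and (-Delta)^(n/2) log (1/|x|) = c delta_0 in the sense
   of distributions on R^n. *)
Definition log_fundamental_constant (c : R) : Prop :=
  0 < c /\
  forall phi, test_function phi ->
    (\int[lebesgue_rV R n]_x
        (ln (1 / enorm x) * neg_laplacian_iter n./2 phi x)%:E =
     (c * phi 0)%:E)%E.

End smooth_functions.

Section strong_A_infinity.
Variables (R : realType) (n : nat).
Implicit Types (omega : 'rV[R]_n -> R) (x y : 'rV[R]_n) (E : set 'rV[R]_n).
Implicit Types (gamma : R -> 'rV[R]_n).

Definition weighted_measure omega E : \bar R :=
  (\int[lebesgue_rV R n]_(x in E) (omega x)%:E)%E.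

Definition locally_integrable_rV omega : Prop :=
  forall K : set 'rV[R]_n, compact K ->
    (lebesgue_rV R n).-integrable K (EFin \o omega).

Definition cube (a : 'rV[R]_n) (l : R) : set 'rV[R]_n :=
  [set x | forall i, a ord0 i <= x ord0 i <= a ord0 i + l].

Definition A_infinity_weight omega : Prop :=
  [/\ forall x, 0 < omega x,
      locally_integrable_rV omega &
      forall eps : R, 0 < eps -> exists2 delta : R, 0 < delta &
        forall (a : 'rV[R]_n) (l : R) E, 0 < l ->
          measurable E -> E `<=` cube a l ->
          (lebesgue_rV R n E <= delta%:E * lebesgue_rV R n (cube a l))%E ->
          (weighted_measure omega E <=
             eps%:E * weighted_measure omega (cube a l))%E].

(* Euclidean length of gamma over [a, b]: supremum over the subdivisions of
   [a, b] of the lengths of the inscribed polygonal lines. *)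
Definition arc_length gamma (a b : R) : \bar R :=
  ereal_sup [set (\sum_(0 <= k < size s)
      enorm (gamma (nth b (a :: s) k.+1) - gamma (nth b (a :: s) k)))%:E
    | s in itv_partition a b].

Definition rectifiable_arc gamma x y : Prop :=
  [/\ {within `[0, 1], continuous gamma}, gamma 0 = x, gamma 1 = y &
      (arc_length gamma 0 1 < +oo)%E].

(* Arc-length parametrization of gamma on [0, 1]: the point gamma t such that
   gamma has length s over [0, t]. It exists for 0 <= s <= length of gamma, and
   it does not depend on the choice of t, since gamma is constant between two
   such t. *)
Definition arc_length_param gamma (s : R) : 'rV[R]_n :=
  gamma (xget 0 [set t | 0 <= t <= 1 /\ arc_length gamma 0 t = s%:E]).

(* The integral of omega^(1/n) along gamma with respect to arc length. *)
Definition weighted_length omega gamma : \bar R :=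
  (\int[lebesgue_measure]_(s in `[0%R, fine (arc_length gamma 0 1)])
     (omega (arc_length_param gamma s) `^ n%:R^-1)%:E)%E.

Definition weighted_distance omega x y : \bar R :=
  ereal_inf [set weighted_length omega gamma
    | gamma in [set gamma | rectifiable_arc gamma x y]].

Definition diametral_ball x y : set 'rV[R]_n :=
  [set z | enorm (z - 2^-1 *: (x + y)) <= enorm (x - y) / 2].

Definition ball_quasidistance omega x y : \bar R :=
  poweR (weighted_measure omega (diametral_ball x y)) n%:R^-1.

Definition strong_A_infinity_weight omega : Prop :=
  A_infinity_weight omega /\
  exists2 C : R, 0 < C &
    forall x y, (ball_quasidistance omega x y <=
                   C%:E * weighted_distance omega x y)%E.

End strong_A_infinity.

(* Main.v *)
Require Import Defs.
From HB Require Import structures.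
From mathcomp Require Import all_boot all_order all_algebra.
From mathcomp Require Import all_classical all_reals all_analysis.
From mathcomp Require Import measurable_realfun ring lra.

(* Split P = Pt + D, where D is bounded, has compact support and mean zero, and
   where the positive part of Pt still has mass less than c.  The potential of D
   is bounded.  On a ball B(o, r), the logarithm of [|y| / |x - y|] may be replaced,
   up to a constant independent of x, by that of [(r + |y - o|) / |x - y|], which is
   nonnegative on B(o, r); so w = A + U - V + O(1) there, where U and V are the
   normalized potentials of pp = max (Pt, 0) / c and pn = max (- Pt, 0) / c.
   Jensen's inequality, together with the integrability of [|x|^-a] for a < n (here
   [a = n * mass of pp], whence the hypothesis on the integral of P), bounds the
   integral of [exp (n U)].  In the other direction the mean of V is O(1) by
   Tonelli, on cubes as well as along curves, so by Chebyshev's inequality V is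
   O(1) on at least half of a cube, and on at least half of the levels [|. - x|] in
   [0, |y - x|] of a curve from x to y, these levels being parametrized by their
   first hitting times. *)

Set Implicit Arguments.
Unset Strict Implicit.
Unset Printing Implicit Defensive.

Import Order.TTheory GRing.Theory Num.Theory.
Import numFieldNormedType.Exports.

Local Open Scope classical_set_scope.
Local Open Scope ring_scope.

(** * Euclidean norm *)

(** The hypothesis bounds the integral of [P] and not that of its positive part, whereas the
    exponent produced by Jensen's inequality is governed by the positive part alone; this is why
    positive mass has to be cancelled against negative mass before anything else.

    The constant [A] attached to a ball is left uncontrolled. Both properties to be proved compare
    two quantities that live on one ball, so exp (n A) occurs on both sides, and only the error [K],
    which is uniform over all balls, survives. Each direction keeps just one potential: U - V is at
    most U and at least - V.

    The integral bounds have the shape T |E| + eta r^n with eta as small as desired; the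
    epsilon-delta form of the A-infinity property is read off from them directly, in place of a
    reverse Hölder inequality.

    For the distance, the obstacle is that a curve may linger near the singularities of V. Selecting
    one point on each sphere around x turns the kernel along the curve into one with a singularity
    of one real variable, with bounds that do not depend on the curve. *)

Section enorm.
Context {R : realType} {n : nat}.
Implicit Types x y z : 'rV[R]_n.

Lemma sqr_enorm x : enorm x ^+ 2 = \sum_(i < n) x ord0 i ^+ 2.
Proof. by rewrite sqr_sqrtr// sumr_ge0// => i _; exact: sqr_ge0. Qed.

Lemma enorm_ge0 x : 0 <= enorm x.
Proof. exact: sqrtr_ge0. Qed.

Lemma coord_le_enorm x i : `|x ord0 i| <= enorm x.
Proof.
rewrite -(ler_pXn2r (n := 2))// ?nnegrE ?enorm_ge0// sqr_enorm.
rewrite real_normK ?num_real// (bigD1 i)//= lerDl.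
by rewrite sumr_ge0// => j _; exact: sqr_ge0.
Qed.

Lemma enorm_eq0 x : (enorm x == 0) = (x == 0).
Proof.
apply/idP/eqP => [/eqP x0|->].
  apply/rowP => i; rewrite mxE; apply/eqP; rewrite -normr_le0.
  by rewrite (le_trans (coord_le_enorm x i))// x0.
by rewrite /enorm big1 ?sqrtr0// => i _; rewrite mxE expr0n.
Qed.

Lemma enorm0 : enorm (0 : 'rV[R]_n) = 0.
Proof. by apply/eqP; rewrite enorm_eq0. Qed.

Lemma enorm_gt0 x : (0 < enorm x) = (x != 0).
Proof. by rewrite lt_def enorm_ge0 andbT enorm_eq0. Qed.

Lemma enormZ k x : enorm (k *: x) = `|k| * enorm x.
Proof.
rewrite /enorm -sqrtr_sqr -sqrtrM ?sqr_ge0// mulr_sumr; congr Num.sqrt.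
by apply: eq_bigr => i _; rewrite mxE exprMn.
Qed.

Lemma enormN x : enorm (- x) = enorm x.
Proof. by rewrite -scaleN1r enormZ normrN normr1 mul1r. Qed.

Lemma enormB x y : enorm (x - y) = enorm (y - x).
Proof. by rewrite -enormN opprB. Qed.

Lemma cauchy_schwarz_enorm x y :
  \sum_(i < n) x ord0 i * y ord0 i <= enorm x * enorm y.
Proof.
have [->|x0] := eqVneq x 0.
  by rewrite enorm0 mul0r big1// => i _; rewrite mxE mul0r.
have [->|y0] := eqVneq y 0.
  by rewrite enorm0 mulr0 big1// => i _; rewrite mxE mulr0.
have a0 : 0 < enorm x by rewrite enorm_gt0.
have b0 : 0 < enorm y by rewrite enorm_gt0.
(* After multiplication by 2 |x| |y|, the inequality is the sum over i of (|y| x_i - |x| y_i)^2 >=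
   0. *)
rewrite -(ler_pM2l (mulr_gt0 a0 b0)) -(ler_pM2l (ltr0Sn R 1)) mulr_sumr.
have -> : 2 * (enorm x * enorm y * (enorm x * enorm y)) =
    enorm y ^+ 2 * enorm x ^+ 2 + enorm x ^+ 2 * enorm y ^+ 2 by ring.
rewrite [in X in _ + _ * X]sqr_enorm [in X in _ * X + _]sqr_enorm !mulr_sumr.
rewrite -big_split; apply: ler_sum => i _ /=.
rewrite -subr_ge0 (_ : _ - _ = (enorm y * x ord0 i - enorm x * y ord0 i) ^+ 2).
  exact: sqr_ge0.
by ring.
Qed.

Lemma enormD x y : enorm (x + y) <= enorm x + enorm y.
Proof.
rewrite -(ler_pXn2r (n := 2)) ?nnegrE ?addr_ge0 ?enorm_ge0// sqrrD !sqr_enorm.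
rewrite (_ : \sum_i _ = \sum_i x ord0 i ^+ 2 +
  (\sum_i x ord0 i * y ord0 i) *+ 2 + \sum_i y ord0 i ^+ 2); last first.
  by rewrite -sumrMnl -!big_split; apply: eq_bigr => i _; rewrite mxE sqrrD.
by rewrite lerD2r lerD2l lerMn2r/= cauchy_schwarz_enorm.
Qed.

Lemma enorm_triangle z x y : enorm (x - y) <= enorm (x - z) + enorm (z - y).
Proof. by rewrite -[x - y](subrKA z) enormD. Qed.

Lemma enorm_rev_triangle x y : `|enorm x - enorm y| <= enorm (x - y).
Proof.
have := enormD (x - y) y; rewrite subrK.
have := enormD (y - x) x; rewrite subrK (enormB y x) => H1 H2.
by rewrite ler_norml; apply/andP; split; lra.
Qed.

Lemma enorm_le_sum x : enorm x <= \sum_(i < n) `|x ord0 i|.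
Proof.
have s0 : 0 <= \sum_(i < n) `|x ord0 i| by exact: sumr_ge0.
rewrite -(ler_pXn2r (n := 2)) ?nnegrE ?enorm_ge0// sqr_enorm expr2 mulr_suml.
apply: ler_sum => i _; rewrite -real_normK ?num_real// expr2 ler_wpM2l//.
by rewrite (bigD1 i)//= lerDl sumr_ge0.
Qed.

Lemma enorm_le_cube x (l : R) : (forall i, `|x ord0 i| <= l) -> enorm x <= n%:R * l.
Proof.
move=> xl; rewrite (le_trans (enorm_le_sum x))//.
rewrite (le_trans (ler_sum _ (fun i _ => xl i)))//.
by rewrite sumr_const card_ord mulr_natl.
Qed.

Lemma measurable_enorm d (T : measurableType d) (f : T -> 'rV[R]_n) :
  (forall i, measurable_fun [set: T] (fun t => f t ord0 i)) ->
  measurable_fun [set: T] (fun t => enorm (f t)).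
Proof.
move=> mf; apply: (measurableT_comp (f := @Num.sqrt R)) => //.
  by apply: continuous_measurable_fun; exact: sqrt_continuous.
have -> : (fun t => \sum_(i < n) f t ord0 i ^+ 2) =
    \sum_(i < n) (fun t => f t ord0 i ^+ 2).
  by apply/funext => t; rewrite fct_sumE.
elim/big_ind : _ => [|g h mg mh|i _].
- exact: measurable_cst.
- exact: measurable_funD.
- exact: measurable_funX.
Qed.

Lemma measurable_enormB1 (z : 'rV[R]_n) :
  measurable_fun [set: 'rV[R]_n] (fun x => enorm (x - z)).
Proof.
apply: measurable_enorm => i; under eq_fun do rewrite !mxE.
by apply: measurable_funD => //; exact: measurable_coord.
Qed.

Lemma measurable_enormB2 (x : 'rV[R]_n) :
  measurable_fun [set: 'rV[R]_n] (fun z => enorm (x - z)).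
Proof. under eq_fun do rewrite enormB. exact: measurable_enormB1. Qed.

Lemma measurable_enormB :
  measurable_fun [set: 'rV[R]_n * 'rV[R]_n] (fun xz => enorm (xz.1 - xz.2)).
Proof.
apply: measurable_enorm => i; under eq_fun do rewrite !mxE.
have mc := @measurable_coord R n i.
by apply: measurable_funB; [exact: (measurableT_comp mc measurable_fst)|
  exact: (measurableT_comp mc measurable_snd)].
Qed.

End enorm.

(** The inverse is the sign, a nondecreasing function, times a power of the absolute value; at 0
    both sides vanish by the convention on [0^-1]. *)
Lemma measurable_inv (R : realType) : measurable_fun [set: R] (@GRing.inv R).
Proof.
have -> : @GRing.inv R = (fun x => Num.sg x * `|x| `^ (-1)).
  apply/funext => x /=; rewrite powR_inv1//.
  case: (sgrP x) => [->|x0|x0]; rewrite ?invr0 ?mul0r ?mul1r//.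
  by rewrite invrN mulN1r opprK.
apply: measurable_funM.
  apply: nondecreasing_measurable => // x y xy.
  by case: (sgrP x) => x0; case: (sgrP y) => y0 //; lra.
apply: (measurableT_comp (f := fun x => x `^ (-1))); first exact: measurable_powR.
exact: normr_measurable.
Qed.

(** * Integrals of singular kernels *)

Lemma geometric_eseries_le (R : realType) (c q : R) : 0 <= c -> 0 < q -> q < 1 ->
  (\sum_(i <oo) (c * q ^+ i)%:E <= (c / (1 - q))%:E)%E.
Proof.
move=> c0 q0 q1; apply: lime_le.
  by apply: is_cvg_nneseries => i _ _; rewrite lee_fin mulr_ge0// exprn_ge0// ltW.
apply: nearW => k; rewrite sumEFin lee_fin.
by apply: geometric_le_lim => //; rewrite ger0_norm// ltW.
Qed.

Lemma measurable_superlevel d (X : measurableType d) (R : realType) (f : X -> R) c :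
  measurable_fun setT f -> measurable [set x | c <= f x].
Proof.
move=> mf; rewrite (_ : [set x | _] = setT `&` f @^-1` `[c, +oo[%classic).
  exact: mf.
by rewrite setTI; apply/seteqP; split => x /=; rewrite in_itv/= andbT.
Qed.

Lemma measurable_sublevel d (X : measurableType d) (R : realType) (f : X -> R) c :
  measurable_fun setT f -> measurable [set x | f x <= c].
Proof.
move=> mf; rewrite (_ : [set x | _] = setT `&` f @^-1` `]-oo, c]%classic).
  exact: mf.
by rewrite setTI; apply/seteqP; split => x /=; rewrite in_itv/=.
Qed.

(** * Dyadic levels of a power *)

Section dyadic.
Context {R : realType}.

(** If 2^(k-1) <= u <= 2^k, then u^a is at most the k-th power of 2^a, which is one of the summands
    as soon as k > J. The levels below 2^J are lumped into the first term: [J] is the parameter by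
    which the series is later made small. *)
Lemma dyadic_powR_le (a : R) (J : nat) (u : R) : 0 < a ->
  ((Num.max 1 u `^ a)%:E <= (2 `^ a ^+ J)%:E +
    \sum_(i <oo) (2 `^ a ^+ (J + i).+1 * \1_[set v : R | 2 ^+ (J + i) <= v] u)%:E)%E.
Proof.
move=> a0; set q := 2 `^ a.
have q1 : 1 <= q.
  have := @ler_powR R 2 (ler1n _ _) 0 a (ltW a0).
  by rewrite powRr0.
have q0 : 0 < q by rewrite (lt_le_trans _ q1).
have s0 i : (0 <= (q ^+ (J + i).+1 * \1_[set v : R | 2 ^+ (J + i) <= v] u)%:E)%E.
  by rewrite lee_fin mulr_ge0// exprn_ge0// ltW.
have qX k : q ^+ k = (2 ^+ k) `^ a.
  by rewrite /q -powR_mulrn ?powR_ge0// -powRrM mulrC powRrM powR_mulrn.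
have uq k : u <= 2 ^+ k -> Num.max 1 u `^ a <= q ^+ k.
  move=> uk; rewrite qX ge0_ler_powR ?nnegrE//; last 2 first.
  - by rewrite le_max ler01.
  - by rewrite ge_max uk andbT exprn_ege1// ler1n.
  - exact: ltW.
have [uJ|Ju] := leP u (2 ^+ J).
  rewrite (@le_trans _ _ (q ^+ J)%:E) ?lee_fin ?uq// leeDl//.
  by apply: nneseries_ge0 => i _ _.
have exk : exists k, u <= 2 ^+ k.
  exists (Num.truncn u).+1; rewrite (le_trans (ltW (truncnS_gt u)))//.
  by rewrite -natrX ler_nat ltnW// ltn_expl.
(* By minimality 2^(k-1) <= u, so the indicator of index i = k - J - 1 equals 1. *)
have := ex_minnP exk; move=> -[k uk kmin].
have Jk : (J < k)%N.
  rewrite ltnNge; apply/negP => kJ; move: Ju; rewrite ltNge => /negP; apply.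
  by rewrite (le_trans uk)// ler_weXn2l// ler1n.
have ku : 2 ^+ k.-1 <= u.
  rewrite leNgt; apply/negP => /ltW /kmin; rewrite leqNgt => /negP; apply.
  by rewrite prednK//; exact: leq_ltn_trans Jk.
rewrite (@le_trans _ _ (q ^+ k)%:E) ?lee_fin ?uq// -[leLHS]add0e leeD//.
  by rewrite lee_fin exprn_ge0// ltW.
apply: (le_trans _ (nneseries_lim_ge (k - J) _)) => //.
have kJ : k = (J + (k - J).-1).+1.
  by rewrite -addnS prednK ?subn_gt0// subnKC// ltnW.
rewrite -(prednK (n := k - J)) ?subn_gt0// big_nat_recr//=.
rewrite -kJ indicE mem_set ?mulr1; last by rewrite /= {1}kJ in ku.
rewrite leeDr// sume_ge0// => i _; exact: s0.
Qed.

End dyadic.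

(* Dyadic decomposition of the singularity; only the growth of the measure of the
   sublevel sets of [dist] matters, so the bound serves both R^n and R. *)
Lemma integral_kernel_le (R : realType) (N : nat) (a kappa eta : R) :
    0 < a < N%:R -> 0 <= kappa -> 0 < eta ->
  exists2 T : R, 0 <= T &
    forall d (X : measurableType d) (mu : {measure set X -> \bar R})
      (dist : X -> R) (r : R) (E : set X),
      measurable_fun setT dist -> 0 < r -> measurable E ->
      (forall s : R, 0 < s -> (mu [set x | (dist x <= s)%R] <= (kappa * s ^+ N)%:E)%E) ->
      (\int[mu]_(x in E) (Num.max 1 (r / dist x) `^ a)%:E <=
         T%:E * mu E + (eta * r ^+ N)%:E)%E.
Proof.
move=> /andP[a0 aN] kappa0 eta0.
pose q : R := 2 `^ a; pose th : R := q / 2 ^+ N.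
have q0 : 0 < q by rewrite powR_gt0.
have th0 : 0 < th by rewrite divr_gt0// exprn_gt0.
have th1 : th < 1.
  rewrite ltr_pdivrMr ?exprn_gt0// mul1r -powR_mulrn// /q.
  by rewrite /powR pnatr_eq0/= ltr_expR ltr_pM2r// ln_gt0// ltr1n.
(* Since a < N, the ratio [th] is below 1 and the tail of the geometric series beyond [J] can be
   made smaller than [eta]. The levels up to [J] contribute at most [q ^+ J] times the measure of
   [E], whence the value of T. *)
have [J HJ] : exists J, kappa * q * th ^+ J / (1 - th) <= eta.
  have := cvg_geometric (kappa * q / (1 - th)) (z := th).
  rewrite ger0_norm ?ltW// => /(_ th1) /cvgrPdist_le /(_ eta eta0).
  move=> -[J _ /(_ J (leqnn J))] /=; rewrite sub0r normrN => HJ.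
  exists J; rewrite (le_trans _ HJ)// mulrAC ler_norm//.
exists (q ^+ J); first by rewrite exprn_ge0// ltW.
move=> d X mu dist r E mdist r0 mE mudist.
have mu0 : measurable_fun setT (fun x => r / dist x).
  by apply: measurable_funM => //; apply: (measurableT_comp (@measurable_inv R)).
pose S i := [set x | (2 ^+ (J + i) <= r / dist x)%R].
have mS i : measurable (S i).
  exact: measurable_superlevel.
pose g i x := (q ^+ (J + i).+1 * \1_(S i) x)%:E.
have mg i : measurable_fun E (g i).
  apply/measurable_EFinP; exact: measurable_funM.
have g0 i x : (0 <= g i x)%E.
  by rewrite lee_fin mulr_ge0// exprn_ge0// ltW.
apply: (@le_trans _ _ (\int[mu]_(x in E) ((q ^+ J)%:E + \sum_(i <oo) g i x))%E).
  apply: ge0_le_integral => //.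
  - by move=> x _; rewrite lee_fin powR_ge0.
  - apply/measurable_EFinP/measurable_funTS.
    apply: (measurableT_comp (f := fun u => u `^ a)); first exact: measurable_powR.
    exact: measurable_maxr.
  - by apply: emeasurable_funD => //; exact: ge0_emeasurable_sum.
  - move=> x _; exact: dyadic_powR_le.
rewrite ge0_integralD//; last 3 first.
  by move=> x _; rewrite lee_fin exprn_ge0// ltW.
  by move=> x _; apply: nneseries_ge0 => i _ _.
  by apply: ge0_emeasurable_sum => //= i x _ _.
rewrite integral_cst// leeD2l// integral_nneseries//.
apply: (@le_trans _ _ (\sum_(i <oo) ((kappa * q * th ^+ J * r ^+ N) * th ^+ i)%:E)%E).
  apply: lee_nneseries => [i _ _|i _]; first exact: integral_ge0.
  rewrite /g; under eq_integral do rewrite EFinM.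
  rewrite ge0_integralZl//; last 2 first.
  - exact/measurable_EFinP.
  - by rewrite lee_fin exprn_ge0// ltW.
  rewrite integral_indic//.
  (* Where r / dist is at least 2^(J+i), dist is positive and at most r / 2^(J+i); the growth
     hypothesis then turns the summand into a multiple of th^(J+i). *)
  apply: (@le_trans _ _ ((q ^+ (J + i).+1)%:E * (kappa * (r / 2 ^+ (J + i)) ^+ N)%:E)%E).
    apply: lee_wpmul2l; first by rewrite lee_fin exprn_ge0// ltW.
    apply: le_trans (mudist (r / 2 ^+ (J + i)) _); last by rewrite divr_gt0// exprn_gt0.
    apply: le_measure; rewrite ?inE.
    - exact: measurableI.
    - exact: measurable_sublevel.
    move=> x [Sx _] /=; rewrite /S/= in Sx.
    have p0 : 0 < (2 : R) ^+ (J + i) by rewrite exprn_gt0.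
    have d0 : 0 < dist x.
      rewrite ltNge; apply/negP => dx.
      have := lt_le_trans p0 Sx; rewrite ltNge => /negP; apply.
      by rewrite mulr_ge0_le0 ?invr_le0// ltW.
    by rewrite ler_pdivlMr// mulrC -ler_pdivlMr.
  rewrite -EFinM lee_fin le_eqVlt; apply/orP; left; apply/eqP.
  rewrite /th !exprMn exprVn -!exprVn -!exprM exprS !exprD.
  by rewrite mulnDl exprD (mulnC J) (mulnC i); ring.
apply: le_trans (geometric_eseries_le _ _ _) _ => //.
  by rewrite !mulr_ge0// ?exprn_ge0// ltW.
rewrite lee_fin mulrAC ler_wpM2r// exprn_ge0// ltW//.
Qed.

(** * Normalized logarithmic kernel *)

Section measure_rV.
Context {R : realType} {n : nat}.
Implicit Types x y z : 'rV[R]_n.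

(** The norm of ['rV[R]_n] is the sup norm, whose balls are cubes; these are the closed Euclidean
    balls. *)
Definition eball (o : 'rV[R]_n) (r : R) : set 'rV[R]_n := [set x | enorm (x - o) <= r].

Lemma measurable_eball o r : measurable (eball o r).
Proof. by apply: measurable_sublevel; exact: measurable_enormB1. Qed.

Lemma measurable_box (A : 'I_n -> set (measurableTypeR R)) :
  (forall i, measurable (A i)) -> measurable [set x : 'rV[R]_n | forall i, A i (x ord0 i)].
Proof.
move=> mA; rewrite (_ : [set x | _] = \bigcap_(i in [set` index_enum 'I_n])
    (fun x : 'rV[R]_n => x ord0 i : measurableTypeR R) @^-1` A i).
  rewrite bigcap_seq; apply: bigsetI_measurable => i _.
  by rewrite -[X in measurable X]setTI; exact: measurable_coord.
by apply/seteqP; split=> x Ax i //=; apply: Ax => /=; exact: mem_index_enum.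
Qed.

Lemma lebesgue_rV_itv_box (a : 'rV[R]_n) (l : R) : 0 <= l ->
  lebesgue_rV R n [set x | forall i, `[a ord0 i, a ord0 i + l]%classic (x ord0 i)] =
  (l ^+ n)%:E.
Proof.
move=> l0; rewrite (@lebesgue_rV_box R n (fun i => `[a ord0 i, a ord0 i + l]%classic))//.
under eq_bigr => i _.
  rewrite lebesgue_measure_itv/= lte_fin ltrDl.
  rewrite (_ : (if _ then _ else _) = l%:E); last first.
    case: ltP => [_|l0']; first by rewrite -EFinB addrAC subrr add0r.
    by have -> : l = 0 by apply/eqP; rewrite eq_le l0 l0'.
  over.
by rewrite prodEFin prodr_const card_ord.
Qed.

Lemma cubeE (a : 'rV[R]_n) (l : R) :
  cube a l = [set x | forall i, `[a ord0 i, a ord0 i + l]%classic (x ord0 i)].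
Proof. by apply/seteqP; split => x /= xa i; have := xa i; rewrite in_itv. Qed.

Lemma measurable_cube (a : 'rV[R]_n) l : measurable (cube a l).
Proof.
rewrite cubeE.
by apply: (@measurable_box (fun i => `[a ord0 i, a ord0 i + l]%classic)).
Qed.

Lemma lebesgue_rV_cube (a : 'rV[R]_n) (l : R) : 0 <= l ->
  lebesgue_rV R n (cube a l) = (l ^+ n)%:E.
Proof. by move=> l0; rewrite cubeE lebesgue_rV_itv_box. Qed.

Lemma lebesgue_rV_eball_le z (s : R) : 0 <= s ->
  (lebesgue_rV R n (eball z s) <= ((2 * s) ^+ n)%:E)%E.
Proof.
move=> s0; rewrite -(@lebesgue_rV_cube (z - const_mx s)) ?mulr_ge0//.
apply: le_measure; rewrite ?inE; [exact: measurable_eball|exact: measurable_cube|].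
move=> x /= xz i; rewrite !mxE.
have := le_trans (coord_le_enorm (x - z) i) xz.
by rewrite !mxE ler_norml => /andP[? ?]; apply/andP; split; lra.
Qed.

Lemma cube_sub_eball (a : 'rV[R]_n) (l : R) : cube a l `<=` eball a (n%:R * l).
Proof.
move=> x xa; apply: enorm_le_cube => i; rewrite !mxE.
have /andP[? ?] := xa i; rewrite ger0_norm; lra.
Qed.

Lemma cube0 z : cube z 0 = [set z].
Proof.
apply/seteqP; split => x /= => [xz|-> i]; last by rewrite addr0 lexx.
by apply/rowP => i; apply/eqP; rewrite eq_le andbC; have := xz i; rewrite addr0.
Qed.

Lemma lebesgue_rV_set1 z : (0 < n)%N -> lebesgue_rV R n [set z] = 0.
Proof.
move=> n0; rewrite -cube0.
by rewrite lebesgue_rV_cube// expr0n; case: (n) n0.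
Qed.

Lemma measurable_set1_rV z : measurable [set z].
Proof. by rewrite -cube0; exact: measurable_cube. Qed.

End measure_rV.

(** * Pointwise bounds for the normalized logarithm *)

Section logker_bounds.
Context {R : realType}.
Implicit Types a r s d : R.

(** Here [r] is the radius of a ball, [s] the distance from its center to the pole, and [d] the
    distance from the pole to a point of the ball, so that the last two hypotheses are triangle
    inequalities. They give d <= r + s <= 2 r + d <= 3 max(r, d). For d = 0 the quotient is 0 and
    [ln 0] is 0. *)
Lemma ln_ratio_bounds r s d : 0 < r -> 0 <= s -> 0 <= d -> d <= r + s -> s <= d + r ->
  0 <= ln ((r + s) / d) <= ln (3 * Num.max 1 (r / d)).
Proof.
move=> r0 s0; rewrite le_eqVlt => /predU1P[<- _ _|d0 drs sdr].
  by rewrite invr0 !mulr0 ln0// lexx/= ln_ge0// mulr_ege1 ?ler1n// le_max lexx.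
apply/andP; split; first by rewrite ln_ge0// ler_pdivlMr ?mul1r.
rewrite ler_ln ?posrE ?divr_gt0 ?mulr_gt0//; [|lra|by rewrite lt_max ltr01].
rewrite ler_pdivrMr//.
have [dr|rd] := leP d r.
  rewrite (@le_trans _ _ (3 * (r / d) * d))//; first by rewrite -mulrA divfK ?gt_eqF//; lra.
  by rewrite ler_pM2r// ler_pM2l// le_max lexx orbT.
rewrite (@le_trans _ _ (3 * 1 * d))//; first lra.
by rewrite ler_pM2r// ler_pM2l// le_max lexx.
Qed.

Lemma expR_ln_ratio_le a r s d : 0 < a -> 0 < r -> 0 <= s -> 0 <= d ->
  d <= r + s -> s <= d + r ->
  expR (a * ln ((r + s) / d)) <= 3 `^ a * Num.max 1 (r / d) `^ a.
Proof.
move=> a0 r0 s0 d0 H1 H2; have /andP[_ H] := ln_ratio_bounds r0 s0 d0 H1 H2.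
have m0 : 0 < Num.max 1 (r / d) by rewrite lt_max ltr01.
rewrite -powRM ?(ltW m0)// /powR gt_eqF ?mulr_gt0// ler_expR ler_pM2l//.
Qed.

(** From 1 + t / 2 <= exp (t / 2) and 3^(1/2) <= 3, whence 6 = 2 * 3. The exponent 1/2 is below
    every dimension at least 1, so the same bound serves in R^n and along a curve. *)
Lemma ln_ratio_le_pow r s d : 0 < r -> 0 <= s -> 0 <= d ->
  d <= r + s -> s <= d + r ->
  ln ((r + s) / d) <= 6 * Num.max 1 (r / d) `^ 2^-1.
Proof.
move=> r0 s0 d0 H1 H2.
have H := @expR_ln_ratio_le 2^-1 r s d _ r0 s0 d0 H1 H2.
have := expR_ge1Dx (2^-1 * ln ((r + s) / d)).
have : 3 `^ 2^-1 <= 3 :> R by rewrite ler1_powR ?ler1n// invf_le1// ler1n.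
have p0 := powR_ge0 (Num.max 1 (r / d)) 2^-1.
have := H (ltac:(by rewrite invr_gt0)); nra.
Qed.

End logker_bounds.

Section logker.
Context {R : realType} {n : nat}.
Implicit Types x y z o : 'rV[R]_n.
Local Notation lambda := (lebesgue_rV R n).

Definition logker o (r : R) x z : R := ln ((r + enorm (z - o)) / enorm (x - z)).

Lemma logker_triangle o r x z : eball o r x ->
  enorm (x - z) <= r + enorm (z - o) /\ enorm (z - o) <= enorm (x - z) + r.
Proof.
rewrite /eball/= => xr; split.
  by rewrite (le_trans (enorm_triangle o x z))// (enormB o z) lerD2r.
by rewrite (le_trans (enorm_triangle x z o))// (enormB z x) lerD2l.
Qed.

Lemma logker_ge0 o r x z : 0 < r -> eball o r x -> 0 <= logker o r x z.
Proof.
move=> r0 /(logker_triangle z)[H1 H2].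
by have /andP[] := ln_ratio_bounds r0 (enorm_ge0 (z - o)) (enorm_ge0 (x - z)) H1 H2.
Qed.

Lemma measurable_logker o r :
  measurable_fun [set: 'rV[R]_n * 'rV[R]_n] (fun xz => logker o r xz.1 xz.2).
Proof.
apply: (measurableT_comp (@measurable_ln R)); apply: measurable_funM.
  apply: measurable_funD => //.
  exact: (measurableT_comp (measurable_enormB1 o) measurable_snd).
exact: (measurableT_comp (@measurable_inv R) measurable_enormB).
Qed.

Lemma measurable_logker1 o r z : measurable_fun [set: 'rV[R]_n] (fun x => logker o r x z).
Proof. exact: (measurableT_comp (measurable_logker o r) (measurable_pair2 z)). Qed.

Lemma measurable_logker2 o r x : measurable_fun [set: 'rV[R]_n] (logker o r x).
Proof. exact: (measurableT_comp (measurable_logker o r) (measurable_pair1 x)). Qed.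

Lemma measurable_singular_kernel (a r : R) z :
  measurable_fun [set: 'rV[R]_n] (fun x => Num.max 1 (r / enorm (x - z)) `^ a).
Proof.
apply: (measurableT_comp (f := fun u => u `^ a)); first exact: measurable_powR.
apply: measurable_maxr => //; apply: measurable_funM => //.
exact: (measurableT_comp (@measurable_inv R) (measurable_enormB1 z)).
Qed.

(** The exponential of the kernel is at most 3^a times the power kernel, so the general bound is
    applied with [eta / 3 ^ a]. The constant depends neither on the ball nor on the pole nor on the
    set. *)
Lemma integral_expR_logker_le (a eta : R) : 0 < a < n%:R -> 0 < eta ->
  exists2 T : R, 0 <= T &
    forall o (r : R) z E, 0 < r -> measurable E -> E `<=` eball o r ->
      (\int[lambda]_(x in E) (expR (a * logker o r x z))%:E <=
         T%:E * lambda E + (eta * r ^+ n)%:E)%E.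
Proof.
move=> an eta0; have /andP[a0 _] := an.
have p0 : 0 < 3 `^ a :> R by rewrite powR_gt0.
have k0 : 0 <= 2 ^+ n :> R by rewrite exprn_ge0.
have [T T0 HT] := integral_kernel_le an k0 (divr_gt0 eta0 p0).
exists (3 `^ a * T); first by rewrite mulr_ge0// ltW.
move=> o r z E r0 mE Er.
apply: (@le_trans _ _ (\int[lambda]_(x in E)
    ((3 `^ a)%:E * (Num.max 1 (r / enorm (x - z)) `^ a)%:E))%E).
  apply: ge0_le_integral => //.
  - apply/measurable_EFinP/measurable_funTS; apply: measurableT_comp => //.
    by apply: measurable_funM => //; exact: measurable_logker1.
  - apply/measurable_EFinP/measurable_funTS; apply: measurable_funM => //.
    exact: measurable_singular_kernel.
  - move=> x /Er /(logker_triangle z)[H1 H2].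
    by rewrite -EFinM lee_fin expR_ln_ratio_le// enorm_ge0.
rewrite ge0_integralZl//; last 2 first.
- apply/measurable_EFinP/measurable_funTS; exact: measurable_singular_kernel.
- by move=> x _; rewrite lee_fin powR_ge0.
have := HT _ _ lambda (fun x => enorm (x - z)) r E (measurable_enormB1 z) r0 mE.
move=> H; rewrite [(3 `^ a * T)%:E]EFinM -muleA.
have -> : (eta * r ^+ n)%:E = ((3 `^ a)%:E * (eta / 3 `^ a * r ^+ n)%:E)%E.
  by rewrite -EFinM; congr EFin; rewrite mulrA (mulrC _ (eta / _)) divfK ?gt_eqF.
rewrite -muleDr//; last by rewrite fin_num_adde_defl.
apply: lee_wpmul2l; first by rewrite lee_fin ltW.
by apply: H => s s0; rewrite -exprMn; apply: lebesgue_rV_eball_le; exact: ltW.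
Qed.

Hypothesis n0 : (0 < n)%N.

Lemma logker_le_expR a o (r : R) x z : 0 < a -> logker o r x z <= a^-1 * expR (a * logker o r x z).
Proof.
move=> a0; rewrite ler_pdivlMl// (le_trans _ (expR_ge1Dx _))//.
by rewrite lerDr.
Qed.

(** The kernel is dominated by twice its exponential with a = 1/2 < n. Uniformity in the pole [z] is
    what Tonelli's theorem will use. *)
Lemma integral_logker_le :
  exists2 T : R, 0 <= T & forall o (r : R) z, 0 < r ->
    (\int[lambda]_(x in eball o r) (logker o r x z)%:E <= (T * r ^+ n)%:E)%E.
Proof.
have a0 : 0 < (2^-1 : R) < n%:R.
  by rewrite invr_gt0 ltr0n/= (@lt_le_trans _ _ 1)// ?invf_lt1 ?ltr1n// ler1n.
have [T T0 HT] := integral_expR_logker_le a0 (@ltr01 R).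
exists (2 * (T * 2 ^+ n + 1)).
  by rewrite mulr_ge0// addr_ge0// mulr_ge0// exprn_ge0.
move=> o r z r0.
have mE := @measurable_eball R n o r.
apply: (@le_trans _ _ (\int[lambda]_(x in eball o r)
    (2%:E * (expR (2^-1 * logker o r x z))%:E))%E).
  apply: ge0_le_integral => //.
  - by move=> x xr; rewrite lee_fin logker_ge0.
  - by apply/measurable_EFinP/measurable_funTS; exact: measurable_logker1.
  - apply/measurable_EFinP/measurable_funTS; apply: measurable_funM => //.
    apply: measurableT_comp => //.
    by apply: measurable_funM => //; exact: measurable_logker1.
  - move=> x _; rewrite -EFinM lee_fin.
    by rewrite (le_trans (@logker_le_expR 2^-1 _ _ _ _ _)) ?invrK// invr_gt0.
rewrite ge0_integralZl//; last first.
  apply/measurable_EFinP/measurable_funTS; apply: measurableT_comp => //.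
  by apply: measurable_funM => //; exact: measurable_logker1.
rewrite -mulrA EFinM; apply: lee_wpmul2l => //.
apply: (le_trans (HT o r z _ r0 mE (@subset_refl _ _))).
rewrite mulrDl EFinD mul1r leeD2r// -mulrA EFinM; apply: lee_wpmul2l => //.
by rewrite -exprMn; apply: lebesgue_rV_eball_le; exact: ltW.
Qed.

End logker.

(** * Logarithmic potentials *)

Section log_potential.
Context {R : realType} {n : nat}.
Hypothesis n0 : (0 < n)%N.
Local Notation lambda := (lebesgue_rV R n).
Implicit Types (f : 'rV[R]_n -> R) (x y z o : 'rV[R]_n) (r : R).

(** Replaces the continuity of [P], which is lost when the density is averaged over a ball; local
    boundedness is what makes the logarithmic singularity integrable against the density. *)
Definition L1_locally_bounded f :=
  lambda.-integrable setT (EFin \o f) /\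
  forall rho : R, exists2 K : R, 0 <= K & forall z, enorm z <= rho -> `|f z| <= K.

Lemma L1_measurable f : L1_locally_bounded f -> measurable_fun setT f.
Proof. by move=> [/measurable_int/measurable_EFinP]. Qed.

Lemma L1_locally_boundedB f g : L1_locally_bounded f -> L1_locally_bounded g ->
  L1_locally_bounded (fun z => f z - g z).
Proof.
move=> [If Kf] [Ig Kg]; split.
  by have := integrableB measurableT If Ig; apply: eq_integrable.
move=> rho; have [K K0 HK] := Kf rho; have [K' K'0 HK'] := Kg rho.
exists (K + K'); first by rewrite addr_ge0.
by move=> z zr; rewrite (le_trans (ler_normB _ _))// lerD// ?HK ?HK'.
Qed.

Lemma integrable_bounded_ball f rho K :
  measurable_fun setT f -> (forall z, `|f z| <= K) -> (forall z, rho < enorm z -> f z = 0) ->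
  lambda.-integrable setT (EFin \o f).
Proof.
move=> mf fK f0; have mB := @measurable_eball R n 0 rho.
have lB : (lambda (eball 0 rho) < +oo)%E.
  have [rho0|rho0] := leP 0 rho.
    by rewrite (le_lt_trans (lebesgue_rV_eball_le _ rho0)) ?ltry.
  rewrite (_ : eball _ _ = set0) ?measure0 ?ltry//.
  by apply/seteqP; split => // x /=; have := enorm_ge0 (x - 0); rewrite /eball/=; lra.
have IB : lambda.-integrable (eball 0 rho) (EFin \o f).
  apply: measurable_bounded_integrable => //; first exact: measurable_funTS.
  exists K; split; first exact: num_real.
  by move=> M KM z _ /=; rewrite (le_trans (fK z))// ltW.
move/(integrable_mkcond _ mB) : IB; apply: eq_integrable => // z _ /=.
rewrite patchE; case: ifPn => // zB; rewrite f0// ltNge.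
by apply: contra zB => zr; rewrite inE /eball/= subr0.
Qed.

Lemma integrable_singular_kernel r x : 0 < r ->
  lambda.-integrable (eball x r)
    (EFin \o (fun z => Num.max 1 (r / enorm (z - x)) `^ 2^-1)).
Proof.
move=> r0; apply/integrableP; split.
  by apply/measurable_EFinP/measurable_funTS; exact: measurable_singular_kernel.
have a0 : 0 < (2^-1 : R) < n%:R.
  by rewrite invr_gt0 ltr0n/= (@lt_le_trans _ _ 1)// ?invf_lt1 ?ltr1n// ler1n.
have [T T0 HT] := integral_kernel_le a0 (exprn_ge0 n (ler0n R 2)) (@ltr01 R).
under eq_integral do rewrite /= ger0_norm ?powR_ge0//.
apply: le_lt_trans (HT _ _ lambda (fun z => enorm (z - x)) r _
   (measurable_enormB1 x) r0 (measurable_eball x r) _) _.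
  by move=> s s0; rewrite -exprMn; apply: lebesgue_rV_eball_le; exact: ltW.
apply: lte_add_pinfty; last exact: ltry.
apply: lte_mul_pinfty; rewrite ?lee_fin//.
by apply: le_lt_trans (lebesgue_rV_eball_le _ (ltW r0)) _; rewrite ltry.
Qed.

(** At distance more than r from x the kernel is at most ln 3, and [f] is integrable; at distance at
    most r it is at most 6 times an integrable power, and [f] is bounded. *)
Lemma integrable_logkerM o r x f : 0 < r -> eball o r x -> L1_locally_bounded f ->
  lambda.-integrable setT (EFin \o (fun z => logker o r x z * f z)).
Proof.
move=> r0 xr Pf; have mf := L1_measurable Pf; case: Pf => If /(_ (enorm x + r))[K K0 HK].
have mB := @measurable_eball R n x r.
pose h := (EFin \o (fun z => Num.max 1 (r / enorm (z - x)) `^ 2^-1)) \_ (eball x r).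
have Ih : lambda.-integrable setT h.
  by apply/(integrable_mkcond _ mB); exact: integrable_singular_kernel.
apply: (@le_integrable _ _ _ _ _ measurableT _
    (fun z => (ln 3)%:E * (`|f z|)%:E + (6 * K)%:E * h z)%E).
- apply/measurable_EFinP; apply: measurable_funM => //; exact: measurable_logker2.
- move=> z _.
  have [H1 H2] := logker_triangle z xr.
  have L0 := logker_ge0 z r0 xr.
  have l3 : 0 <= ln 3 :> R by rewrite ln_ge0// ler1n.
  rewrite /= normrM (ger0_norm L0) /h patchE; case: ifPn => zB.
    have {zB} zB : enorm (z - x) <= r by move: zB; rewrite inE.
    have fK : `|f z| <= K.
      by apply: HK; have := enormD (z - x) x; rewrite subrK; lra.
    rewrite -!EFinM -EFinD abse_EFin lee_fin [in leRHS]ger0_norm; last first.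
      by rewrite addr_ge0// ?mulr_ge0// powR_ge0.
    rewrite (@le_trans _ _ (6 * Num.max 1 (r / enorm (z - x)) `^ 2^-1 * K))//; last first.
      by rewrite mulrAC lerDr mulr_ge0.
    apply: ler_pM => //.
    have := ln_ratio_le_pow r0 (enorm_ge0 (z - o)) (enorm_ge0 (x - z)) H1 H2.
    by rewrite -(enormB x z).
  have {zB} zB : r < enorm (z - x).
    by rewrite ltNge; apply: contra zB; rewrite inE.
  rewrite mule0 adde0 -EFinM abse_EFin lee_fin [in leRHS]ger0_norm ?mulr_ge0//.
  apply: ler_wpM2r => //.
  have /andP[_] := ln_ratio_bounds r0 (enorm_ge0 (z - o)) (enorm_ge0 (x - z)) H1 H2.
  rewrite (_ : Num.max _ _ = 1) ?mulr1//; apply/max_idPl.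
  rewrite enormB ler_pdivrMr ?mul1r; last exact: lt_trans zB.
  exact: ltW.
- apply: integrableD => //; apply: integrableZl => //.
  by have := integrable_abse If; apply: eq_integrable.
Qed.

Lemma integrable_boundedM (k : 'rV[R]_n -> R) f (K : R) :
  measurable_fun setT k -> (forall z, `|k z| <= K) ->
  lambda.-integrable setT (EFin \o f) ->
  lambda.-integrable setT (EFin \o (fun z => k z * f z)).
Proof.
move=> mk kK If; have mf : measurable_fun setT f by move: If => /measurable_int/measurable_EFinP.
apply: (@le_integrable _ _ _ _ _ measurableT _ (fun z => K%:E * (f z)%:E)%E).
- by apply/measurable_EFinP; exact: measurable_funM.
- move=> z _ /=; rewrite lee_fin !normrM ler_wpM2r//.
  by rewrite (le_trans (kK z))// ler_norm.
- exact: integrableZl.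
Qed.

(** Both r + |z - o| and 1 + |z| grow like |z| and stay away from 0, so changing from one
    normalization to the other costs a bounded amount. *)
Lemma bounded_ln_ratio o r : 0 < r -> exists K : R, forall z : 'rV[R]_n,
  `|ln ((r + enorm (z - o)) / (1 + enorm z))| <= K.
Proof.
move=> r0; set a := 1 + r + enorm o; set b := 1 + (1 + enorm o) / r.
have o0 := enorm_ge0 o.
have b1 : 1 <= b by rewrite lerDl divr_ge0 ?addr_ge0// ltW.
exists (ln a + ln b) => z; have z0 := enorm_ge0 z; have zo0 := enorm_ge0 (z - o).
have H1 : enorm (z - o) <= enorm z + enorm o by rewrite -(enormN o) enormD.
have H2 : enorm z <= enorm (z - o) + enorm o by have := enormD (z - o) o; rewrite subrK.
have D0 : 0 < 1 + enorm z by lra.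
have a0 : 0 < a by rewrite /a; lra.
have M0 : 0 < r + enorm (z - o) by lra.
have lna : 0 <= ln a by rewrite ln_ge0// /a; lra.
have lnb : 0 <= ln b by rewrite ln_ge0.
rewrite ler_norml; apply/andP; split; last first.
  rewrite (@le_trans _ _ (ln a)) ?lerDl//.
  rewrite ler_ln ?posrE ?divr_gt0// ler_pdivrMr// /a.
  have : 0 <= (r + enorm o) * enorm z by rewrite mulr_ge0//; lra.
  nra.
rewrite lerNl -lnV ?posrE ?divr_gt0// invf_div (@le_trans _ _ (ln b)) ?lerDr//.
rewrite ler_ln ?posrE ?divr_gt0//; last lra.
rewrite ler_pdivrMr// /b mulrDl mul1r.
have : (1 + enorm o) / r * (r + enorm (z - o)) = 1 + enorm o + (1 + enorm o) / r * enorm (z - o).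
  by field; rewrite gt_eqF.
have : 0 <= (1 + enorm o) / r * enorm (z - o) by rewrite mulr_ge0// divr_ge0; lra.
lra.
Qed.

Lemma ae_eq_off_two_points (x : 'rV[R]_n) (f g : 'rV[R]_n -> R) :
  (forall z, z != x -> z != 0 -> f z = g z) ->
  ae_eq lambda setT (EFin \o f) (EFin \o g).
Proof.
move=> fg; exists ([set x] `|` [set 0]); split.
- by apply: measurableU; exact: measurable_set1_rV.
- apply/eqP; rewrite eq_le measure_ge0 andbT.
  rewrite (le_trans (measureU2 _ _ _))//; try exact: measurable_set1_rV.
  by rewrite [X in (X + _)%E]lebesgue_rV_set1// [X in (_ + X)%E]lebesgue_rV_set1// adde0.
- move=> z /= Hz; apply: contrapT => /not_orP[zx z0]; apply: Hz => _.
  by rewrite fg//; exact/eqP.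
Qed.

(** Meant for splitting ln (|z| / |x - z|) into logarithms, which is legitimate only where neither
    |z| nor |x - z| is 0; the two exceptional points form a null set. *)
Lemma integral_eq_off_two_points (x : 'rV[R]_n) (f g : 'rV[R]_n -> R) :
  measurable_fun setT f -> lambda.-integrable setT (EFin \o g) ->
  (forall z, z != x -> z != 0 -> f z = g z) ->
  lambda.-integrable setT (EFin \o f) /\ \int[lambda]_z f z = \int[lambda]_z g z.
Proof.
move=> mf Ig fg; have /integrableP[mg goo] := Ig; split.
  apply/integrableP; split; first exact/measurable_EFinP.
  rewrite (ae_eq_integral (abse \o (EFin \o g)))//.
  - by apply: measurableT_comp => //; exact/measurable_EFinP.
  - exact: measurableT_comp.
  - have := @ae_eq_off_two_points x (fun z => `|f z|) (fun z => `|g z|) _.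
    by apply => z zx z0; rewrite fg.
rewrite /Rintegral (ae_eq_integral (EFin \o g))//; first exact/measurable_EFinP.
exact: (ae_eq_off_two_points (x := x)).
Qed.

Lemma measurable_potential_integrand x :
  measurable_fun [set: 'rV[R]_n] (fun y => ln (enorm y / enorm (x - y))).
Proof.
apply: (measurableT_comp (@measurable_ln R)); apply: measurable_funM.
  by have := @measurable_enormB1 R n 0; under eq_fun do rewrite subr0.
exact: (measurableT_comp (@measurable_inv R) (measurable_enormB2 x)).
Qed.

(* The singularity at the base point 0 is traded for the normalization by
   [r + |y - o|], which is adapted to the ball of center [o] and radius [r]. *)
Lemma potential_renormalize o r f : 0 < r -> L1_locally_bounded f ->
  exists B : R, forall x, eball o r x ->
    lambda.-integrable setT (EFin \o (fun y => ln (enorm y / enorm (x - y)) * f y)) /\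
    \int[lambda]_y (ln (enorm y / enorm (x - y)) * f y) =
      \int[lambda]_y (logker o r x y * f y) - B.
Proof.
move=> r0 Pf; have mf := L1_measurable Pf.
have [K HK] := @bounded_ln_ratio o r r0.
pose k z := ln ((r + enorm (z - o)) / (1 + enorm z)).
have mk : measurable_fun setT k.
  apply: (measurableT_comp (@measurable_ln R)); apply: measurable_funM.
    by apply: measurable_funD => //; exact: measurable_enormB1.
  apply: (measurableT_comp (@measurable_inv R)); apply: measurable_funD => //.
  by have := @measurable_enormB1 R n 0; under eq_fun do rewrite subr0.
have o1 : eball (0 : 'rV[R]_n) 1 0 by rewrite /eball/= subr0 enorm0.
(* Away from z = 0 this is ln ((r + |z - o|) / |z|) f(z), the difference of the two normalizations:
   a bounded part, and the kernel of the unit ball about 0 evaluated at x = 0. It does not involve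
   [x], so its integral is the constant B. *)
pose g z := k z * f z + logker 0 1 0 z * f z.
have Ik : lambda.-integrable setT (EFin \o (fun z => k z * f z)).
  by apply: integrable_boundedM HK _ => //; case: Pf.
have I0 := integrable_logkerM (@ltr01 R) o1 Pf.
have Ig : lambda.-integrable setT (EFin \o g).
  by have := integrableD measurableT Ik I0; apply: eq_integrable.
exists (\int[lambda]_z g z) => x xr.
have Ix := integrable_logkerM r0 xr Pf.
pose h z := logker o r x z * f z - g z.
have Ih : lambda.-integrable setT (EFin \o h).
  by have := integrableB measurableT Ix Ig; apply: eq_integrable.
have mF : measurable_fun setT (fun y => ln (enorm y / enorm (x - y)) * f y).
  by apply: measurable_funM => //; exact: measurable_potential_integrand.
have fh z : z != x -> z != 0 -> ln (enorm z / enorm (x - z)) * f z = h z.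
  move=> zx z0.
  have a0 : 0 < enorm z by rewrite enorm_gt0.
  have b0 : 0 < enorm (x - z) by rewrite enorm_gt0 subr_eq0 eq_sym.
  have M0 : 0 < r + enorm (z - o) by have := enorm_ge0 (z - o); lra.
  have D0 : 0 < 1 + enorm z by lra.
  rewrite /h /g -mulrDl -mulrBl; congr (_ * _); rewrite /logker /k sub0r enormN subr0.
  by rewrite !ln_div ?posrE//; ring.
have [IF ->] := integral_eq_off_two_points mF Ih fh.
by split => //; rewrite -RintegralB.
Qed.

End log_potential.

(** * Splitting of the density *)

Lemma Rintegral_splitC d (T : measurableType d) (R : realType)
    (mu : {measure set T -> \bar R}) (B : set T) (f : T -> R) :
  measurable B -> mu.-integrable setT (EFin \o f) ->
  \int[mu]_z f z = \int[mu]_(z in B) f z + \int[mu]_(z in ~` B) f z.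
Proof.
move=> mB If; rewrite -Rintegral_setU ?setUv//; first exact: measurableC.
by apply/disj_setPS; rewrite setICr.
Qed.

Section decomposition.
Context {R : realType} {n : nat}.
Hypothesis n0 : (0 < n)%N.
Local Notation lambda := (lebesgue_rV R n).
Implicit Types (f D P : 'rV[R]_n -> R) (x y z o : 'rV[R]_n) (r rho : R).

(** The two arguments of the kernel are exchanged: the pole is now the fixed point [x], anywhere in
    space, and the variable of integration runs over the ball carrying [D]. The bound on the
    integral over the ball, being uniform in the pole, is uniform in [x]. *)
Lemma integrable_logker_pole rho : 0 < rho -> exists2 T : R, 0 <= T &
  forall D K x, measurable_fun setT D -> (forall z, `|D z| <= K) ->
    (forall z, rho < enorm z -> D z = 0) ->
    lambda.-integrable setT (EFin \o (fun z => logker 0 rho z x * D z)) /\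
    `|\int[lambda]_z (logker 0 rho z x * D z)| <= K * T.
Proof.
move=> r0; have [T T0 HT] := @integral_logker_le R n n0.
exists (T * rho ^+ n); first by rewrite mulr_ge0// exprn_ge0// ltW.
move=> D K x mD DK D0.
pose B : set 'rV[R]_n := eball 0 rho.
have mB : measurable B := @measurable_eball R n 0 rho.
have K0 : 0 <= K by rewrite (le_trans _ (DK 0)).
pose h : 'rV[R]_n -> R := (fun z => K * logker 0 rho z x) \_ B.
have HB : (\int[lambda]_(z in B) (K * logker 0 rho z x)%:E <= (K * (T * rho ^+ n))%:E)%E.
  under eq_integral do rewrite EFinM.
  rewrite ge0_integralZl//.
  - by rewrite EFinM lee_wpmul2l// HT.
  - by apply/measurable_EFinP/measurable_funTS; exact: measurable_logker1.
  - by move=> z zB; rewrite lee_fin logker_ge0.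
have h0 z : 0 <= h z.
  by rewrite /h patchE; case: ifPn => // /set_mem zB; rewrite mulr_ge0// logker_ge0.
have hE : (\int[lambda]_z (h z)%:E = \int[lambda]_(z in B) (K * logker 0 rho z x)%:E)%E.
  rewrite [RHS]integral_mkcond; apply: eq_integral => z _.
  by rewrite /h !patchE; case: ifPn.
have Ih : lambda.-integrable setT (EFin \o h).
  apply/integrableP; split.
    apply/measurable_EFinP; apply/(measurable_restrictT _ mB); apply/measurable_funTS.
    by apply: measurable_funM => //; exact: measurable_logker1.
  under eq_integral do rewrite /= ger0_norm//.
  by rewrite hE (le_lt_trans HB)// ltry.
have kh z : `|logker 0 rho z x * D z| <= h z.
  rewrite /h patchE; case: ifPn => [/set_mem zB|zB].
    by rewrite normrM ger0_norm ?logker_ge0// mulrC ler_wpM2r// logker_ge0.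
  rewrite D0 ?mulr0 ?normr0// ltNge; apply: contra zB => zr.
  by rewrite inE /B/eball/= subr0.
have mk : measurable_fun setT (fun z => logker 0 rho z x * D z).
  by apply: measurable_funM => //; exact: measurable_logker1.
have Ik : lambda.-integrable setT (EFin \o (fun z => logker 0 rho z x * D z)).
  apply: le_integrable Ih => //; first exact/measurable_EFinP.
  by move=> z _; rewrite /= lee_fin (ger0_norm (h0 z)).
split=> //.
rewrite (le_trans (le_normr_Rintegral measurableT Ik))//.
have In : lambda.-integrable setT (EFin \o (fun z => `|logker 0 rho z x * D z|)).
  by have := integrable_abse Ik; apply: eq_integrable.
rewrite (le_trans (le_Rintegral measurableT In Ih (fun z _ => kh z)))//.
rewrite /Rintegral -lee_fin fineK; first by rewrite hE.
exact: integrable_fin_num.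
Qed.

(** Up to null sets ln (|z| / |x - z|) equals [logker 0 rho z x - logker 0 rho z 0 - t] with t = ln
    ((rho + |x|) / rho). The term t is unbounded in x but independent of z, so the zero mean of [D]
    removes it; the second term integrates to a constant, the first to a bounded function. *)
Lemma potential_mean_zero D rho K :
  0 < rho -> measurable_fun setT D -> (forall z, `|D z| <= K) ->
  (forall z, rho < enorm z -> D z = 0) -> \int[lambda]_z D z = 0 ->
  exists B K' : R, forall x, `|\int[lambda]_y (ln (enorm y / enorm (x - y)) * D y) - B| <= K'.
Proof.
move=> r0 mD DK D0 D00; have [T T0 HT] := integrable_logker_pole r0.
have ID := integrable_bounded_ball mD DK D0.
exists (- \int[lambda]_z (logker 0 rho z 0 * D z)), (K * T) => x.
have [I0 _] := HT D K 0 mD DK D0; have [Ix Tx] := HT D K x mD DK D0.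
pose t := ln ((rho + enorm x) / rho).
pose h z := logker 0 rho z x * D z - (logker 0 rho z 0 * D z + t * D z).
have It : lambda.-integrable setT (EFin \o (fun z => t * D z)).
  by have := integrableZl measurableT t ID; apply: eq_integrable.
have I2 : lambda.-integrable setT (EFin \o (fun z => logker 0 rho z 0 * D z + t * D z)).
  by have := integrableD measurableT I0 It; apply: eq_integrable.
have Ih : lambda.-integrable setT (EFin \o h).
  by have := integrableB measurableT Ix I2; apply: eq_integrable.
have mF : measurable_fun setT (fun y => ln (enorm y / enorm (x - y)) * D y).
  by apply: measurable_funM => //; exact: measurable_potential_integrand.
have fh z : z != x -> z != 0 -> ln (enorm z / enorm (x - z)) * D z = h z.
  move=> zx z0.
  have a0 : 0 < enorm z by rewrite enorm_gt0.
  have b0 : 0 < enorm (x - z) by rewrite enorm_gt0 subr_eq0 eq_sym.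
  have x0 : 0 < rho + enorm x by have := enorm_ge0 x; lra.
  rewrite /h -mulrDl -mulrBl; congr (_ * _); rewrite /logker /t !subr0 enorm0 addr0.
  by rewrite (enormB z x) !ln_div ?posrE//; ring.
have [_ ->] := integral_eq_off_two_points n0 mF Ih fh.
have -> : \int[lambda]_z h z = \int[lambda]_z (logker 0 rho z x * D z) -
    \int[lambda]_z (logker 0 rho z 0 * D z + t * D z) by exact: RintegralB.
have -> : \int[lambda]_z (logker 0 rho z 0 * D z + t * D z) =
    \int[lambda]_z (logker 0 rho z 0 * D z) + \int[lambda]_z (t * D z) by exact: RintegralD.
have -> : \int[lambda]_z (t * D z) = t * \int[lambda]_z D z by exact: RintegralZl.
move: Tx; rewrite D00.
move: (\int[lambda]_z (logker 0 rho z x * D z)) (\int[lambda]_z (logker 0 rho z 0 * D z)).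
by move=> u v uT; rewrite mulr0 addr0 opprK subrK.
Qed.

Lemma tail_small P (eps : R) : 0 < eps -> lambda.-integrable setT (EFin \o P) ->
  exists2 rho : R, 0 < rho & \int[lambda]_(z in ~` eball 0 rho) `|P z| <= eps.
Proof.
move=> eps0 IP.
pose B (k : nat) : set 'rV[R]_n := eball 0 k.+1%:R.
have mB k : measurable (B k) by exact: measurable_eball.
have IN : lambda.-integrable setT (EFin \o (fun z => `|P z|)).
  by have := integrable_abse IP; apply: eq_integrable.
have BT : \bigcup_k B k = setT.
  apply/seteqP; split => // z _; exists (Num.truncn (enorm z)) => //.
  by rewrite /B /eball/= subr0 ltW// truncnS_gt.
have := @ge0_nondecreasing_set_cvg_integral _ _ _ B (EFin \o (fun z => `|P z|)) lambda _ mB _ _.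
have h1 : {homo B : k m / (k <= m)%N >-> (k <= m)%O}.
  move=> k m km; rewrite subsetEset => z; rewrite /B /eball/= => /le_trans; apply.
  by rewrite ler_nat.
move=> /(_ h1) H.
have : (\int[lambda]_(x in B i) (EFin \o (fun z => `|P z|%R)) x @[i --> \oo] -->
   \int[lambda]_(x in setT) (EFin \o (fun z => `|P z|%R)) x)%E.
  rewrite -BT; apply: H => [k|k z _]; last by rewrite lee_fin.
  by apply: measurable_funTS; exact: measurable_int IN.
have If k : lambda.-integrable (B k) (EFin \o (fun z => `|P z|)).
  by apply: (integrableS measurableT) IN.
have Ic k : lambda.-integrable (~` B k) (EFin \o (fun z => `|P z|)).
  by apply: (integrableS measurableT) IN => //; exact: measurableC.
rewrite -(fineK (integrable_fin_num measurableT IN)).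
move=> /fine_cvgP[_] /cvgrPdist_le /(_ eps eps0)[k _ /(_ k (leqnn k))] /= Hk.
exists k.+1%:R; first by rewrite ltr0n.
rewrite -/(B k).
have E := Rintegral_splitC (mB k) IN.
apply: le_trans Hk; rewrite -[fine (\int[lambda]_x _)]/(Rintegral lambda setT (fun z => `|P z|)) E.
by rewrite /Rintegral addrAC subrr add0r ler_norm.
Qed.

Lemma lebesgue_rV_eball_gt0 rho : 0 < rho -> 0 < fine (lambda (eball 0 rho)).
Proof.
move=> r0; have n1 : 0 < n%:R :> R by rewrite ltr0n.
rewrite -lte_fin fineK; last first.
  rewrite ge0_fin_numE//; apply: le_lt_trans (lebesgue_rV_eball_le 0 (ltW r0)) _.
  by rewrite ltry.
apply: (@lt_le_trans _ _ (lambda (cube 0 (rho / n%:R)))).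
  rewrite [ltRHS]lebesgue_rV_cube ?divr_ge0//; last exact: ltW.
  by rewrite lte_fin exprn_gt0// divr_gt0.
apply: le_measure; rewrite ?inE; [exact: measurable_cube|exact: measurable_eball|].
move=> z /cube_sub_eball; rewrite /eball/= mulrC divfK// gt_eqF//.
Qed.

(** On a ball so large that |P| has integral at most [e] outside, [P] is replaced by its mean m.
    There the positive part now has mass max(m, 0) times the volume, hence at most max(S, 0) + e,
    because all cancellation has taken place; outside the ball it has mass at most e. *)
Lemma redistribute_mass P (c : R) : 0 < c -> L1_locally_bounded P ->
  \int[lambda]_z P z < c ->
  exists (Pt : 'rV[R]_n -> R) (rho K : R), [/\ 0 < rho, L1_locally_bounded Pt,
    \int[lambda]_z Num.max (Pt z) 0 < c,
    (forall z, `|P z - Pt z| <= K) &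
    (forall z, rho < enorm z -> P z - Pt z = 0) /\ \int[lambda]_z (P z - Pt z) = 0].
Proof.
move=> c0 HP Pc; have mP := L1_measurable HP; have [IP bP] := HP.
set S := \int[lambda]_z P z in Pc.
(* One third of the gap, since two errors of size [e] occur. The maximum with 0 covers the case of a
   negative total integral. *)
pose e := (c - Num.max S 0) / 3.
have e0 : 0 < e by rewrite divr_gt0// subr_gt0 gt_max Pc c0.
have [rho r0 Hrho] := tail_small e0 IP.
pose B : set 'rV[R]_n := eball 0 rho.
have mB : measurable B by exact: measurable_eball.
have mBc : measurable (~` B) by exact: measurableC.
pose l := fine (lambda B); have l0 : 0 < l by exact: lebesgue_rV_eball_gt0.
pose m := (\int[lambda]_(z in B) P z) / l.
have [K K0 HK] := bP rho.
pose D : 'rV[R]_n -> R := (fun z => P z - m) \_ B.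
have mD : measurable_fun setT D.
  by apply/(measurable_restrictT _ mB); apply/measurable_funTS; exact: measurable_funB.
have DK z : `|D z| <= K + `|m|.
  rewrite /D patchE; case: ifPn => [/set_mem zB|_]; last by rewrite normr0 addr_ge0.
  rewrite (le_trans (ler_normB _ _))// lerD2r HK//.
  by move: zB; rewrite /B/eball/= subr0.
have D0 z : rho < enorm z -> D z = 0.
  move=> zr; rewrite /D patchE; case: ifPn => // /set_mem; rewrite /B/eball/= subr0.
  by rewrite leNgt zr.
have ID := integrable_bounded_ball mD DK D0.
have PB : L1_locally_bounded D.
  by split=> // s; exists (K + `|m|) => //; rewrite addr_ge0.
have IPB : lambda.-integrable B (EFin \o P) by exact: (integrableS measurableT).
have IPBc : lambda.-integrable (~` B) (EFin \o P) by exact: (integrableS measurableT).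
have lB : (lambda B < +oo)%E.
  by apply: le_lt_trans (lebesgue_rV_eball_le 0 (ltW r0)) _; rewrite ltry.
have Icst k : lambda.-integrable B (EFin \o cst k).
  apply: measurable_bounded_integrable => //.
  by exists `|k|; split; [exact: num_real|move=> M kM z _ /=; exact: ltW].
have DE : \int[lambda]_z D z = 0.
  rewrite /D -Rintegral_mkcond RintegralB//; last exact: (Icst m).
  by rewrite Rintegral_cst// -/l /m divfK ?gt_eqF// subrr.
pose Pt z := P z - D z.
have PtD z : P z - Pt z = D z by rewrite /Pt opprB addrC subrK.
have HPt : L1_locally_bounded Pt by exact: L1_locally_boundedB.
exists Pt, rho, (K + `|m|); split => //; last 2 first.
- by move=> z; rewrite PtD.
- split; first by move=> z zr; rewrite PtD D0.
  by under eq_Rintegral do rewrite PtD.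
have IPt : lambda.-integrable setT (EFin \o (fun z => Num.max (Pt z) 0)).
  by have [I _] := HPt; have := integrable_funrpos measurableT I; apply: eq_integrable.
rewrite (Rintegral_splitC mB IPt).
have H1 : \int[lambda]_(z in B) Num.max (Pt z) 0 = Num.max m 0 * l.
  rewrite -(Rintegral_cst lambda mB); apply: eq_Rintegral => z zB.
  by rewrite /Pt /D patchE zB subKr.
have H2 : \int[lambda]_(z in ~` B) Num.max (Pt z) 0 <= e.
  apply: le_trans Hrho; apply: le_Rintegral => //.
  - exact: (integrableS measurableT).
  - have := integrable_abse IPBc; apply: eq_integrable => //.
  - move=> z zB; rewrite /Pt /D patchE ifF ?subr0.
      by rewrite ge_max ler_norm normr_ge0.
    by apply/negP => /set_mem.
have ml : m * l <= S + e.
  rewrite /m divfK ?gt_eqF// /S (Rintegral_splitC mB IP) -addrA lerDl.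
  rewrite -lerBlDl sub0r.
  have := le_normr_Rintegral mBc IPBc; rewrite ler_norml => /andP[H3 _].
  by rewrite lerNl (le_trans _ H3)// lerN2.
have ml0 : Num.max m 0 * l <= Num.max S 0 + e.
  case: (leP m 0) => _; first by rewrite mul0r addr_ge0// ?le_max ?lexx ?orbT// ltW.
  by rewrite (le_trans ml)// lerD2r le_max lexx.
rewrite H1; move: H2 ml0; rewrite /e; set M := Num.max S 0 => H2 ml0.
have : M < c by rewrite gt_max Pc c0.
lra.
Qed.

(** Kept with values in the extended reals, so that Tonelli's theorem applies to it directly;
    finiteness is added where a real value is needed. *)
Definition gauge_pot f o r x : \bar R := (\int[lambda]_z (logker o r x z * f z)%:E)%E.

(** The order of the quantifiers is the point: the densities and [K] are fixed once for all balls,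
    and only [A] may depend on the ball. The error comes solely from the compensated density
    [P - Pt]; for [Pt] the change of normalization is an exact identity. *)
Lemma potential_decomposition P (c C : R) (w : 'rV[R]_n -> R) : 0 < c ->
  L1_locally_bounded P -> \int[lambda]_z P z < c ->
  (forall x, w x = 1 / c * \int[lambda]_y (ln (enorm y / enorm (x - y)) * P y) + C) ->
  exists pp pn : 'rV[R]_n -> R, exists K : R,
    [/\ L1_locally_bounded pp /\ L1_locally_bounded pn,
        (forall z, 0 <= pp z) /\ (forall z, 0 <= pn z),
        \int[lambda]_z pp z < 1 &
        forall o r, 0 < r -> exists A : R, forall x, eball o r x ->
          [/\ gauge_pot pp o r x \is a fin_num, gauge_pot pn o r x \is a fin_num &
              `|w x - (A + (fine (gauge_pot pp o r x) - fine (gauge_pot pn o r x)))| <= K]].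
Proof.
move=> c0 HP Pc wE.
have [Pt [rho [K [rho0 HPt Ptc DK [D0 DE]]]]] := redistribute_mass c0 HP Pc.
have HD := L1_locally_boundedB HP HPt.
have mD := L1_measurable HD.
have [B [K' HB]] := potential_mean_zero rho0 mD DK D0 DE.
pose pp z := c^-1 * Num.max (Pt z) 0; pose pn z := c^-1 * Num.max (- Pt z) 0.
have ci0 : 0 < c^-1 by rewrite invr_gt0.
have [IPt bPt] := HPt.
have Ip : lambda.-integrable setT (EFin \o (fun z => Num.max (Pt z) 0)).
  by have := integrable_funrpos measurableT IPt; apply: eq_integrable.
have In : lambda.-integrable setT (EFin \o (fun z => Num.max (- Pt z) 0)).
  by have := integrable_funrneg measurableT IPt; apply: eq_integrable.
have HZ f : (forall z, `|f z| <= `|Pt z|) -> lambda.-integrable setT (EFin \o f) ->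
    L1_locally_bounded (fun z => c^-1 * f z).
  move=> fP If; split.
    by have := integrableZl measurableT c^-1 If; apply: eq_integrable.
  move=> s; have [M M0 HM] := bPt s; exists (c^-1 * M); first by rewrite mulr_ge0// ltW.
  move=> z zs; rewrite normrM gtr0_norm// ler_wpM2l ?(ltW ci0)//.
  by rewrite (le_trans (fP z))// HM.
have Hpp : L1_locally_bounded pp.
  apply: HZ => // z; case: (leP (Pt z) 0); rewrite ?normr0//.
have Hpn : L1_locally_bounded pn.
  apply: HZ => // z; case: (leP (- Pt z) 0); rewrite ?normr0// normrN//.
exists pp, pn, (c^-1 * K'); split => //.
- by split => z; rewrite mulr_ge0 ?(ltW ci0)// le_max lexx orbT.
- by rewrite /pp RintegralZl// mulrC ltr_pdivrMr// mul1r.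
move=> o r r0.
have [B1 HB1] := potential_renormalize n0 o r0 HPt.
have [B3 HB3] := potential_renormalize n0 o r0 HD.
(* [B] is the central value of the potential of [P - Pt], and [B1] the constant lost in
   renormalizing the potential of [Pt]. *)
exists (c^-1 * (B - B1) + C) => x xr.
have Lp := integrable_logkerM n0 r0 xr Hpp.
have Ln := integrable_logkerM n0 r0 xr Hpn.
split; [exact: integrable_fin_num|exact: integrable_fin_num|].
have [I1 E1] := HB1 x xr; have [I3 _] := HB3 x xr.
have EP : \int[lambda]_y (ln (enorm y / enorm (x - y)) * P y) =
    \int[lambda]_y (ln (enorm y / enorm (x - y)) * Pt y) +
    \int[lambda]_y (ln (enorm y / enorm (x - y)) * (P y - Pt y)).
  rewrite -RintegralD//; apply: eq_Rintegral => y _.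
  by rewrite [RHS]addrC mulrBr subrK.
have EL : \int[lambda]_y (logker o r x y * Pt y) =
    c * (fine (gauge_pot pp o r x) - fine (gauge_pot pn o r x)).
  rewrite /gauge_pot -[fine _]/(Rintegral lambda setT (fun z => logker o r x z * pp z)).
  rewrite -[X in _ * (_ - X)]/(Rintegral lambda setT (fun z => logker o r x z * pn z)).
  have LB : lambda.-integrable setT
      (EFin \o (fun z => logker o r x z * pp z - logker o r x z * pn z)).
    by have := integrableB measurableT Lp Ln; apply: eq_integrable.
  rewrite -RintegralB// -RintegralZl//; apply: eq_Rintegral => z _.
  rewrite -mulrBr mulrCA; congr (_ * _); rewrite /pp /pn -mulrBr mulrA divff ?gt_eqF// mul1r.
  by case: (leP (Pt z) 0) => Pz; case: (leP (- Pt z) 0) => Pz'; lra.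
rewrite wE EP E1 EL.
have := HB x; move: (fine _) (fine _) (\int[lambda]_y _) => u v t HBx.
rewrite (_ : _ - _ = c^-1 * (t - B)).
  by rewrite normrM gtr0_norm// ler_wpM2l// ltW.
by rewrite div1r; field; rewrite gt_eqF.
Qed.

End decomposition.

(** * Exponential integrals of potentials *)

Section measure_lemmas.
Context {R : realType}.

(* Jensen's inequality for a measure of mass at most one; the first summand
   pays for the missing mass. *)
Lemma expR_Rintegral_le d (T : measurableType d) (mu : {measure set T -> \bar R})
    (b q : T -> R) :
  measurable_fun setT b -> (forall z, 0 <= q z) -> mu.-integrable setT (EFin \o q) ->
  mu.-integrable setT (EFin \o (fun z => b z * q z)) -> \int[mu]_z q z <= 1 ->
  ((expR (\int[mu]_z (b z * q z)))%:E <=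
    (expR 1)%:E + \int[mu]_z (expR (b z) * q z)%:E)%E.
Proof.
move=> mb q0 Iq Ibq q1; set a := \int[mu]_z (b z * q z).
have mq : measurable_fun setT q by move: Iq => /measurable_int/measurable_EFinP.
have meq : measurable_fun setT (fun z => expR (b z) * q z).
  by apply: measurable_funM => //; exact: measurableT_comp.
have I0 : (0 <= \int[mu]_z (expR (b z) * q z)%:E)%E.
  by apply: integral_ge0 => z _; rewrite lee_fin mulr_ge0// expR_ge0.
have [a1|a1] := leP a 1.
  by apply: (@le_trans _ _ (expR 1)%:E); [rewrite lee_fin ler_expR|rewrite leeDl].
have [->|Ifin] := eqVneq (\int[mu]_z (expR (b z) * q z)%:E)%E +oo%E.
  by rewrite addeC addye// leey.
have Ie : mu.-integrable setT (EFin \o (fun z => expR (b z) * q z)).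
  apply/integrableP; split; first exact/measurable_EFinP.
  under eq_integral do rewrite /= ger0_norm ?mulr_ge0 ?expR_ge0//.
  by rewrite ltey.
rewrite -[leLHS]add0e leeD ?lee_fin ?expR_ge0//.
rewrite -[leRHS]fineK ?(integrable_fin_num measurableT Ie)// lee_fin.
(* The tangent at a, exp b >= exp a * (1 + b - a), multiplied by [q]. Integration gives exp a * (a -
   (a - 1) k) with k the mass of q, and this is at least exp a because k <= 1 and a > 1. *)
pose g z := expR a * (b z * q z - (a - 1) * q z).
have Ia : mu.-integrable setT (EFin \o (fun z => (a - 1) * q z)).
  by have := integrableZl measurableT (a - 1) Iq; apply: eq_integrable.
have Id : mu.-integrable setT (EFin \o (fun z => b z * q z - (a - 1) * q z)).
  by have := integrableB measurableT Ibq Ia; apply: eq_integrable.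
have Ig : mu.-integrable setT (EFin \o g).
  by have := integrableZl measurableT (expR a) Id; apply: eq_integrable.
apply: (@le_trans _ _ (\int[mu]_z g z)); last first.
  apply: le_Rintegral => // z _; rewrite /g -mulrBl mulrA ler_wpM2r//.
  have -> : expR (b z) = expR (b z - a) * expR a by rewrite -expRD subrK.
  rewrite mulrC ler_wpM2r ?expR_ge0// (le_trans _ (expR_ge1Dx _))//.
  by rewrite opprB addrCA.
rewrite /g RintegralZl// RintegralB// RintegralZl// -/a.
rewrite -[leLHS]mulr1 ler_wpM2l ?expR_ge0//.
have : (a - 1) * \int[mu]_z q z <= (a - 1) * 1 by rewrite ler_wpM2l// subr_ge0 ltW.
by move: (\int[mu]_z q z) => k; lra.
Qed.

(** Chebyshev's inequality: the set where V >= 2 K + 1 has measure at most K m / (2 K + 1) <= m / 2.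
    The added 1 keeps the threshold positive when K = 0. *)
Lemma half_measure_sublevel d (T : measurableType d) (mu : {measure set T -> \bar R})
    (Q : set T) (V : T -> \bar R) (m K : R) :
  measurable Q -> mu Q = m%:E -> 0 <= K -> measurable_fun Q V ->
  (forall x, Q x -> 0 <= V x)%E -> (\int[mu]_(x in Q) V x <= (K * m)%:E)%E ->
  ((m / 2)%:E <= mu (Q `&` [set x | (V x <= (2 * K + 1)%:E)%E]))%E.
Proof.
move=> mQ Qm K0 mV V0 VK.
have m0 : 0 <= m by rewrite -lee_fin -Qm.
have a0 : 0 < 2 * K + 1 by rewrite ltr_wpDl// mulr_ge0.
have := @le_integral_abse _ _ _ mu Q mQ V (2 * K + 1) mV a0.
set G := Q `&` [set x | (V x <= (2 * K + 1)%:E)%E].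
set H := Q `&` _ => HV.
have mG : measurable G by exact: emeasurable_fun_infty_c.
have mH : measurable H.
  by apply: emeasurable_fun_c_infty => //; exact: measurableT_comp.
have HK : ((2 * K + 1)%:E * mu H <= (K * m)%:E)%E.
  apply: (le_trans HV); apply: le_trans VK; apply: ge0_le_integral => //.
  - exact: measurableT_comp.
  - by move=> x Qx; rewrite gee0_abs// V0.
have Hfin : mu H \is a fin_num.
  rewrite ge0_fin_numE//; apply: (@le_lt_trans _ _ (mu Q)); last by rewrite Qm ltry.
  by apply: le_measure; rewrite ?inE// => x [].
have Gfin : mu G \is a fin_num.
  rewrite ge0_fin_numE//; apply: (@le_lt_trans _ _ (mu Q)); last by rewrite Qm ltry.
  by apply: le_measure; rewrite ?inE// => x [].
have QGH : (mu Q <= mu G + mu H)%E.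
  apply: (@le_trans _ _ (mu (G `|` H))); last exact: measureU2.
  apply: le_measure; rewrite ?inE//; first exact: measurableU.
  move=> x Qx; have [VxK|KVx] := leP (V x) (2 * K + 1)%:E; [by left|right; split => //=].
  by rewrite gee0_abs ?V0// ltW.
move: HK QGH; rewrite Qm -(fineK Hfin) -(fineK Gfin) -EFinM -EFinD !lee_fin.
have : 0 <= fine (mu H) by rewrite fine_ge0.
move: (fine (mu H)) (fine (mu G)) => h g h0 hK mgh.
have : h <= m / 2.
  rewrite -(ler_pM2l a0) (le_trans hK)//; lra.
lra.
Qed.

End measure_lemmas.

(** * Tonelli's theorem for a kernel integrated against a density *)

Section tonelli.
Context {R : realType} d1 d2 (X : measurableType d1) (Y : measurableType d2).
Variables (m1 : {sigma_finite_measure set X -> \bar R})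
  (m2 : {sigma_finite_measure set Y -> \bar R}).
Variables (Q : set X) (k : X * Y -> R) (p : Y -> R).
Hypotheses (mQ : measurable Q) (mk : measurable_fun setT k).
Hypotheses (k0 : forall x y, Q x -> 0 <= k (x, y)) (p0 : forall y, 0 <= p y).
Hypothesis mp : measurable_fun setT p.

(** The kernel is nonnegative only above [Q]; the indicator makes the integrand nonnegative on the
    whole product. *)
Let F (xy : X * Y) : \bar R := (k xy * p xy.2 * \1_Q xy.1)%:E.

Let F0 xy : (0 <= F xy)%E.
Proof.
rewrite lee_fin /F indicE; have [xQ|xQ] := boolP (xy.1 \in Q); last by rewrite mulr0.
by rewrite mulr1 mulr_ge0// (surjective_pairing xy) k0//; exact: set_mem.
Qed.

Let mF : measurable_fun setT F.
Proof.
apply/measurable_EFinP; apply: measurable_funM; last first.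
  apply: (measurableT_comp (f := \1_Q : X -> R)); last exact: measurable_fst.
  exact: measurable_indic.
by apply: measurable_funM => //; exact: (measurableT_comp mp measurable_snd).
Qed.

Let FE x : Q x -> (\int[m2]_y F (x, y) = \int[m2]_y (k (x, y) * p y)%:E)%E.
Proof.
by move=> Qx; apply: eq_integral => y _; rewrite /F/= indicE mem_set// mulr1.
Qed.

Lemma measurable_fun_weighted_integral :
  measurable_fun Q (fun x => \int[m2]_y (k (x, y) * p y)%:E)%E.
Proof.
apply: (eq_measurable_fun (fun x => \int[m2]_y F (x, y))%E).
  by move=> x /set_mem Qx; exact: FE.
apply: measurable_funTS; exact: measurable_fun_fubini_tonelli_F.
Qed.

Lemma integral_kernel_mass_le (B N : R) : 0 <= B ->
  (forall y, (\int[m1]_(x in Q) (k (x, y))%:E <= B%:E)%E) ->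
  (\int[m2]_y (p y)%:E <= N%:E)%E ->
  (\int[m1]_(x in Q) \int[m2]_y (k (x, y) * p y)%:E <= (B * N)%:E)%E.
Proof.
move=> B0 kB pN.
rewrite [leLHS](_ : _ = \int[m1]_x \int[m2]_y F (x, y))%E; last first.
  rewrite integral_mkcond; apply: eq_integral => x _; rewrite patchE.
  case: ifPn => [/set_mem Qx|xQ]; first by rewrite FE.
  rewrite [RHS]integral0_eq// => y _.
  by rewrite /F/= indicE (negbTE xQ) mulr0.
rewrite fubini_tonelli//.
apply: (@le_trans _ _ (\int[m2]_y (B%:E * (p y)%:E))%E); last first.
  rewrite ge0_integralZl//.
  - by rewrite EFinM; apply: lee_wpmul2l.
  - exact/measurable_EFinP.
  - by move=> y _; rewrite lee_fin.
apply: ge0_le_integral => //.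
- by move=> y _; apply: integral_ge0 => x _.
- exact: measurable_fun_fubini_tonelli_G.
- by apply/measurable_EFinP; exact: measurable_funM.
- move=> y _.
  have mky : measurable_fun Q (fun x => (k (x, y))%:E).
    apply/measurable_EFinP/measurable_funTS.
    exact: (measurableT_comp mk (measurable_pair2 y)).
  rewrite [leLHS](_ : _ = (p y)%:E * \int[m1]_(x in Q) (k (x, y))%:E)%E; last first.
    rewrite -ge0_integralZl//; last 2 first.
    - by move=> x Qx; rewrite lee_fin k0.
    - by rewrite lee_fin.
    rewrite [RHS]integral_mkcond; apply: eq_integral => x _; rewrite patchE /F/= indicE.
    by case: (x \in Q); rewrite ?mulr1 ?mulr0// mulrC EFinM.
  by rewrite muleC; apply: lee_wpmul2r; rewrite ?lee_fin.
Qed.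

End tonelli.

(** * Integral bounds for potentials on balls and cubes *)

Section gauge_bounds.
Context {R : realType} {n : nat}.
Hypothesis n0 : (0 < n)%N.
Local Notation lambda := (lebesgue_rV R n).
Implicit Types (p : 'rV[R]_n -> R) (o x y z : 'rV[R]_n) (r : R) (E : set 'rV[R]_n).

Lemma integral_fine p : L1_locally_bounded p ->
  (\int[lambda]_z (p z)%:E = (\int[lambda]_z p z)%:E)%E.
Proof. by move=> [Ip _]; rewrite fineK//; exact: integrable_fin_num. Qed.

Lemma gauge_pot_fin_num p o r x : 0 < r -> eball o r x -> L1_locally_bounded p ->
  gauge_pot p o r x \is a fin_num.
Proof. by move=> r0 xr Pp; apply: integrable_fin_num => //; exact: integrable_logkerM. Qed.

Lemma measurable_gauge_pot p o r E : 0 < r -> measurable E -> E `<=` eball o r ->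
  L1_locally_bounded p -> (forall z, 0 <= p z) -> measurable_fun E (gauge_pot p o r).
Proof.
move=> r0 mE Er Pp p0; rewrite /gauge_pot.
have := @measurable_fun_weighted_integral R _ _ _ _ lambda E
  (fun xz => logker o r xz.1 xz.2) p mE (measurable_logker o r) _ p0 (L1_measurable Pp).
by apply => x y /Er xr; exact: logker_ge0.
Qed.

Lemma integral_gauge_pot_le p : L1_locally_bounded p -> (forall z, 0 <= p z) ->
  exists2 K : R, 0 <= K & forall o r E, 0 < r -> measurable E -> E `<=` eball o r ->
    (\int[lambda]_(x in E) gauge_pot p o r x <= (K * r ^+ n)%:E)%E.
Proof.
move=> Pp p0; have [T T0 HT] := @integral_logker_le R n n0.
exists (T * \int[lambda]_z p z); first by rewrite mulr_ge0// Rintegral_ge0.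
move=> o r E r0 mE Er; rewrite mulrAC.
apply: (@integral_kernel_mass_le R _ _ _ _ lambda lambda E
  (fun xz => logker o r xz.1 xz.2) p mE (measurable_logker o r) _ p0 (L1_measurable Pp)).
- by move=> x y /Er xr; exact: logker_ge0.
- by rewrite mulr_ge0// exprn_ge0// ltW.
- move=> z; apply: le_trans (HT o r z r0); apply: ge0_subset_integral => //.
  + exact: measurable_eball.
  + by apply/measurable_EFinP/measurable_funTS; exact: measurable_logker1.
  + by move=> x xr; rewrite lee_fin logker_ge0.
- by rewrite integral_fine.
Qed.

(** Writing n U as the integral of n th [logker] against q = p / th, with q of mass at most 1,
    Jensen's inequality and Tonelli's theorem reduce the claim to the exponential integral of the
    kernel with exponent n th < n. *)
Lemma integral_expR_gauge_pot_le p (eta : R) : L1_locally_bounded p ->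
  (forall z, 0 <= p z) -> \int[lambda]_z p z < 1 -> 0 < eta ->
  exists2 T : R, 0 <= T & forall o r E, 0 < r -> measurable E -> E `<=` eball o r ->
    (\int[lambda]_(x in E) (expR (n%:R * fine (gauge_pot p o r x)))%:E <=
      T%:E * lambda E + (eta * r ^+ n)%:E)%E.
Proof.
move=> Pp p0 p1 eta0; have [Ip _] := Pp; have mp := L1_measurable Pp.
have m0 : 0 <= \int[lambda]_z p z by exact: Rintegral_ge0.
(* Halfway between the mass and 1: below 1, so that the singularity stays integrable, and positive
   even for zero mass, so that division by [th] makes sense. *)
pose th := (1 + \int[lambda]_z p z) / 2.
have [th0 pth th1] : [/\ 0 < th, \int[lambda]_z p z <= th & th < 1].
  by rewrite /th; move: (\int[lambda]_z p z) m0 p1 => m m0 m1; split; lra.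
have n1 : 0 < n%:R :> R by rewrite ltr0n.
have a0 : 0 < n%:R * th < n%:R by rewrite mulr_gt0//= gtr_pMr.
have [T T0 HT] := integral_expR_logker_le a0 eta0.
exists (expR 1 + T); first by rewrite addr_ge0// expR_ge0.
move=> o r E r0 mE Er.
pose q z := th^-1 * p z.
have q0 z : 0 <= q z by rewrite mulr_ge0// invr_ge0 ltW.
have mq : measurable_fun setT q by exact: measurable_funM.
have Iq : lambda.-integrable setT (EFin \o q).
  by have := integrableZl measurableT th^-1 Ip; apply: eq_integrable.
have q1 : \int[lambda]_z q z <= 1 by rewrite RintegralZl// ler_pdivrMl// mulr1.
pose k (xz : 'rV[R]_n * 'rV[R]_n) := expR (n%:R * th * logker o r xz.1 xz.2).
have mk : measurable_fun setT k.
  by apply: measurableT_comp => //; apply: measurable_funM => //; exact: measurable_logker.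
have k0 x z : E x -> 0 <= k (x, z) by move=> _; exact: expR_ge0.
have lE : (lambda E < +oo)%E.
  apply: (@le_lt_trans _ _ (lambda (eball o r))).
    by apply: le_measure; rewrite ?inE//; exact: measurable_eball.
  by apply: le_lt_trans (lebesgue_rV_eball_le _ (ltW r0)) _; rewrite ltry.
have jensen x : E x -> ((expR (n%:R * fine (gauge_pot p o r x)))%:E <=
    (expR 1)%:E + \int[lambda]_z (k (x, z) * q z)%:E)%E.
  move=> /Er xr.
  have Il := integrable_logkerM n0 r0 xr Pp.
  have Ib : lambda.-integrable setT (EFin \o (fun z => n%:R * th * logker o r x z * q z)).
    have := integrableZl measurableT n%:R Il; apply: eq_integrable => // z _ /=.
    by rewrite -EFinM /q; congr EFin; field; rewrite gt_eqF.
  have mb : measurable_fun setT (fun z => n%:R * th * logker o r x z).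
    by apply: measurable_funM => //; exact: measurable_logker2.
  have -> : n%:R * fine (gauge_pot p o r x) =
      \int[lambda]_z (n%:R * th * logker o r x z * q z).
    rewrite -[fine _]/(Rintegral lambda setT (fun z => logker o r x z * p z)).
    rewrite -RintegralZl//; apply: eq_Rintegral => z _.
    by rewrite /q; field; rewrite gt_eqF.
  exact: expR_Rintegral_le.
have mI : measurable_fun E (fun x => \int[lambda]_z (k (x, z) * q z)%:E)%E.
  exact: measurable_fun_weighted_integral.
apply: (@le_trans _ _ (\int[lambda]_(x in E)
    ((expR 1)%:E + \int[lambda]_z (k (x, z) * q z)%:E))%E).
  apply: ge0_le_integral => //; last exact: emeasurable_funD.
  apply/measurable_EFinP; apply: measurableT_comp => //; apply: measurable_funM => //.
  apply: (measurableT_comp (f := @fine R)); first exact: fine_measurable.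
  exact: measurable_gauge_pot.
rewrite ge0_integralD//; last by move=> x Ex; apply: integral_ge0 => z _; rewrite lee_fin mulr_ge0// k0.
rewrite integral_cst// EFinD ge0_muleDl ?lee_fin ?expR_ge0// -addeA leeD2l//.
apply: (@le_trans _ _ ((T * fine (lambda E) + eta * r ^+ n) * 1)%:E).
  apply: integral_kernel_mass_le => //.
  - by rewrite addr_ge0// mulr_ge0 ?fine_ge0// ?(ltW eta0)// exprn_ge0// ltW.
  - move=> z; apply: (le_trans (HT o r z E r0 mE Er)).
    by rewrite [leRHS]EFinD [in leRHS]EFinM fineK// ge0_fin_numE.
  - by rewrite -[leLHS]fineK ?(integrable_fin_num measurableT Iq)// lee_fin.
by rewrite mulr1 [leLHS]EFinD [in leLHS]EFinM fineK// ge0_fin_numE.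
Qed.

Lemma integral_cube_expRN_gauge_pot_ge p : L1_locally_bounded p -> (forall z, 0 <= p z) ->
  exists2 kappa : R, 0 < kappa & forall (a : 'rV[R]_n) (l : R), 0 < l ->
    ((kappa * l ^+ n)%:E <= \int[lambda]_(x in cube a l)
      (expR (- (n%:R * fine (gauge_pot p a (n%:R * l) x))))%:E)%E.
Proof.
move=> Pp p0; have [T T0 HT] := integral_gauge_pot_le Pp p0.
have n1 : 0 < n%:R :> R by rewrite ltr0n.
(* The cube lies in the ball of radius n l about its corner [a], whence the factor n^n relative to
   l^n. *)
pose K := T * n%:R ^+ n.
have K0 : 0 <= K by rewrite mulr_ge0// exprn_ge0.
exists (expR (- (n%:R * (2 * K + 1))) / 2); first by rewrite divr_gt0// expR_gt0.
move=> a l l0; set r := n%:R * l.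
have r0 : 0 < r by rewrite mulr_gt0.
have mQ := @measurable_cube R n a l.
have Qr : cube a l `<=` eball a r by exact: cube_sub_eball.
have mg := measurable_gauge_pot r0 mQ Qr Pp p0.
have g0 x : cube a l x -> (0 <= gauge_pot p a r x)%E.
  by move=> /Qr xr; apply: integral_ge0 => z _; rewrite lee_fin mulr_ge0// logker_ge0.
have QK : (\int[lambda]_(x in cube a l) gauge_pot p a r x <= (K * l ^+ n)%:E)%E.
  by rewrite /K -mulrA -exprMn; exact: HT.
have := half_measure_sublevel mQ (lebesgue_rV_cube a (ltW l0)) K0 mg g0 QK.
set G := cube a l `&` _ => HG.
have mG : measurable G by exact: emeasurable_fun_infty_c.
have mf : measurable_fun (cube a l) (fun x => (expR (- (n%:R * fine (gauge_pot p a r x))))%:E).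
  apply/measurable_EFinP; apply: measurableT_comp => //; apply: measurable_funN.
  apply: measurable_funM => //.
  by apply: (measurableT_comp (f := @fine R)) => //; exact: fine_measurable.
apply: (@le_trans _ _ (\int[lambda]_(x in G) (expR (- (n%:R * (2 * K + 1))))%:E)%E).
  rewrite integral_cst// mulrAC -mulrA EFinM; exact: lee_wpmul2l.
apply: (@le_trans _ _ (\int[lambda]_(x in G)
    (expR (- (n%:R * fine (gauge_pot p a r x))))%:E)%E); last first.
  by apply: ge0_subset_integral => // x [].
apply: ge0_le_integral => //.
- by apply: measurable_funS mf => // x [].
- move=> x [Qx]/= gK; rewrite lee_fin ler_expR lerN2 ler_pM2l//.
  by rewrite -lee_fin fineK//; apply: gauge_pot_fin_num => //; exact: Qr.
Qed.

End gauge_bounds.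

(** * Arc length *)

Section arc_length.
Context {R : realType} {n : nat}.
Variable gamma : R -> 'rV[R]_n.
Implicit Types (a b c t : R) (s : seq R).
Local Notation len := (arc_length gamma).

Fixpoint polygon_length a s : R :=
  if s is x :: s' then enorm (gamma x - gamma a) + polygon_length x s' else 0.

Lemma polygon_lengthE a b s :
  \sum_(0 <= k < size s) enorm (gamma (nth b (a :: s) k.+1) - gamma (nth b (a :: s) k)) =
  polygon_length a s.
Proof.
elim: s a => [a|x s IH a]; first by rewrite big_nil.
by rewrite /= big_nat_recl//= -IH.
Qed.

Lemma polygon_length_rcons a s c :
  polygon_length a (rcons s c) = polygon_length a s + enorm (gamma c - gamma (last a s)).
Proof. by elim: s a => [a|x s IH a] /=; rewrite ?addr0 ?add0r// IH addrA. Qed.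

Lemma polygon_length_le_arc_length a b s : path <%R a s -> last a s = b ->
  ((polygon_length a s)%:E <= len a b)%E.
Proof.
move=> ps ls; apply: ereal_sup_ubound; exists s; first by split => //; rewrite ls.
by rewrite polygon_lengthE.
Qed.

Lemma arc_length_le a b (y : \bar R) :
  (forall s, path <%R a s -> last a s = b -> ((polygon_length a s)%:E <= y)%E) ->
  (len a b <= y)%E.
Proof.
by move=> H; apply: ge_ereal_sup => _ [s [ps /eqP ls] <-]; rewrite polygon_lengthE H.
Qed.

Lemma arc_length_ge a b : a <= b -> ((enorm (gamma b - gamma a))%:E <= len a b)%E.
Proof.
rewrite le_eqVlt => /predU1P[<-|ab].
  by rewrite subrr enorm0 (@polygon_length_le_arc_length a a [::]).
have := @polygon_length_le_arc_length a b [:: b]; rewrite /= addr0; apply => //.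
by rewrite ab.
Qed.

Lemma arc_length_ge0 a b : a <= b -> (0 <= len a b)%E.
Proof. by move=> ab; rewrite (le_trans _ (arc_length_ge ab))// lee_fin enorm_ge0. Qed.

Lemma arc_length_cons a x b : a < x -> x <= b ->
  ((enorm (gamma x - gamma a))%:E + len x b <= len a b)%E.
Proof.
move=> ax xb; rewrite -leeBrDl//; apply: arc_length_le => s ps ls.
rewrite leeBrDl// -EFinD.
by apply: (@polygon_length_le_arc_length a b (x :: s)); rewrite /= ?ax.
Qed.

Lemma arc_length_rcons a b c : a <= b -> b < c ->
  (len a b + (enorm (gamma c - gamma b))%:E <= len a c)%E.
Proof.
move=> ab bc; rewrite -leeBrDr//; apply: arc_length_le => s ps ls.
rewrite leeBrDr// -EFinD -ls -polygon_length_rcons.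
by apply: polygon_length_le_arc_length; rewrite ?last_rcons// rcons_path ps ls.
Qed.

(** Subdivision points up to b are peeled off one at a time. When the next point passes b, the point
    b is inserted, which can only lengthen the polygon by the triangle inequality. *)
Lemma arc_length_triangle a b c : a <= b -> b <= c -> (len a c <= len a b + len b c)%E.
Proof.
move=> ab bc; apply: arc_length_le => s; elim: s a ab => [|x s IH] a ab /=.
  by move=> _ _; rewrite adde_ge0// arc_length_ge0.
move=> /andP[ax ps] ls; have [xb|bx] := leP x b.
  rewrite EFinD (@le_trans _ _ ((enorm (gamma x - gamma a))%:E + (len x b + len b c))%E)//.
    by rewrite leeD2l// IH.
  by rewrite addeA leeD2r// arc_length_cons.
rewrite (@le_trans _ _ ((enorm (gamma b - gamma a))%:E +
  (enorm (gamma x - gamma b) + polygon_length x s)%:E)%E)//.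
  by rewrite -EFinD lee_fin addrA lerD2r addrC; exact: enorm_triangle.
rewrite leeD// ?arc_length_ge//.
by apply: (@polygon_length_le_arc_length b c (x :: s)); rewrite //= bx.
Qed.

Let coord (i : 'I_n) t := gamma t ord0 i.

Lemma variation_coord_le a b i s : itv_partition a b s ->
  ((variation a b (coord i) s)%:E <= len a b)%E.
Proof.
move=> [ps /eqP ls]; apply: le_trans (polygon_length_le_arc_length ps ls).
rewrite -(polygon_lengthE a b) lee_fin /variation; apply: ler_sum => k _.
have := coord_le_enorm (gamma (nth b (a :: s) k.+1) - gamma (nth b (a :: s) k)) i.
by rewrite !mxE.
Qed.

Lemma bounded_variation_coord a b i : (len a b < +oo)%E -> bounded_variation a b (coord i).
Proof.
move=> lab; exists (fine (len a b)) => _ [s abs <-].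
have := variation_coord_le i abs; by case: (len a b) lab.
Qed.

(** The Euclidean norm is at most the sum of the absolute coordinates. The bound serves to transfer
    to arc length the continuity of the total variation of a continuous function. *)
Lemma arc_length_le_total_variation a b :
  (len a b <= \sum_(i < n) total_variation a b (coord i))%E.
Proof.
apply: arc_length_le => s ps ls; have abs : itv_partition a b s by split; rewrite ?ls.
rewrite -(polygon_lengthE a b).
apply: (@le_trans _ _ (\sum_(i < n) (variation a b (coord i) s)%:E)%E); last first.
  apply: lee_sum => i _; apply: ereal_sup_ubound; exists (variation a b (coord i) s) => //.
  exact: variations_variation.
rewrite sumEFin lee_fin /variation exchange_big/=; apply: ler_sum => k _.
apply: (le_trans (enorm_le_sum _)); apply: ler_sum => i _.
by rewrite !mxE.
Qed.

End arc_length.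

(** * Arc-length parametrization *)

Section arc_length_parametrization.
Context {R : realType} {n : nat}.
Variables (gamma : R -> 'rV[R]_n) (x y : 'rV[R]_n).
Hypothesis rect : rectifiable_arc gamma x y.
Implicit Types s t : R.
Local Notation len := (arc_length gamma).
Let L := fine (len 0 1).
Let coord (i : 'I_n) t := gamma t ord0 i.

Let len_fin t : 0 <= t <= 1 -> len 0 t \is a fin_num.
Proof.
move=> /andP[t0 t1]; have [_ _ _ l1] := rect; rewrite ge0_fin_numE ?arc_length_ge0//.
apply: le_lt_trans l1; move: t1; rewrite le_eqVlt => /predU1P[->//|t1].
by apply: (le_trans _ (arc_length_rcons gamma t0 t1)); rewrite leeDl// lee_fin enorm_ge0.
Qed.

Let Lam t := fine (len 0 t).

Let LamE t : 0 <= t <= 1 -> len 0 t = (Lam t)%:E.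
Proof. by move=> t01; rewrite /Lam fineK// len_fin. Qed.

Let enorm_le_Lam t t' : 0 <= t -> t <= t' -> t' <= 1 ->
  enorm (gamma t' - gamma t) <= Lam t' - Lam t.
Proof.
move=> t0 + t1; rewrite le_eqVlt => /predU1P[<-|tt']; first by rewrite !subrr enorm0.
have := arc_length_rcons gamma t0 tt'; rewrite !LamE.
- by rewrite -EFinD lee_fin lerBrDl.
- by rewrite t1 (le_trans t0)// ltW.
- by rewrite t0 (le_trans _ t1)// ltW.
Qed.

Let bvar i : bounded_variation 0 1 (coord i).
Proof. by have [_ _ _ l1] := rect; exact: bounded_variation_coord. Qed.

Let TV i t := fine (total_variation 0 t (coord i)).

Let TV_fin i a b : 0 <= a -> a <= b -> b <= 1 -> total_variation a b (coord i) \is a fin_num.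
Proof.
move=> a0 ab b1; apply/bounded_variationP => //.
by apply: (bounded_variationl ab b1); apply: bounded_variationr (bvar i) => //; exact: le_trans b1.
Qed.

(** Increments of length are dominated by increments of the summed variations, which are continuous;
    this is the source of the continuity of [Lam]. *)
Let Lam_le_TV t t' : 0 <= t -> t <= t' -> t' <= 1 ->
  Lam t' - Lam t <= \sum_(i < n) TV i t' - \sum_(i < n) TV i t.
Proof.
move=> t0 tt' t1.
have t'0 := le_trans t0 tt'; have t1' := le_trans tt' t1.
have : (len 0 t' <= len 0 t + \sum_(i < n) total_variation t t' (coord i))%E.
  apply: (le_trans (arc_length_triangle gamma t0 tt')); rewrite leeD2l//.
  exact: arc_length_le_total_variation.
rewrite !LamE ?t0 ?t1 ?t'0//.
have -> : (\sum_(i < n) total_variation t t' (coord i) =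
    (\sum_(i < n) (TV i t' - TV i t))%:E)%E.
  rewrite -sumEFin; apply: eq_bigr => i _.
  rewrite /TV (total_variationD (coord i) t0 tt') fineD ?TV_fin//.
  by rewrite addrAC subrr add0r fineK ?TV_fin.
by rewrite -EFinD lee_fin sumrB lerBlDl.
Qed.

Let Lam_mono t t' : 0 <= t -> t <= t' -> t' <= 1 -> Lam t <= Lam t'.
Proof.
by move=> t0 tt' t1; rewrite -subr_ge0 (le_trans (enorm_ge0 _) (enorm_le_Lam t0 tt' t1)).
Qed.

Let TVsum_cont : {within `[0, 1], continuous (fun t => \sum_(i < n) TV i t)}.
Proof.
have cTV i : {within `[0, 1], continuous (TV i)}.
  apply: total_variation_continuous => //.
  have [cg _ _ _] := rect => t.
  exact: (continuous_comp (cg t) (@coord_continuous R _ _ ord0 i _)).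
elim: (index_enum _) => [|i r IH].
  rewrite (_ : (fun t => _) = fun=> 0); first by move=> t; exact: cst_continuous.
  by apply/funext => t; rewrite big_nil.
rewrite (_ : (fun t => _) = (fun t => TV i t + \sum_(j <- r) TV j t)).
  by move=> t; apply: (@continuousD _ _ _ (TV i : subspace _ -> R)); [exact: cTV|exact: IH].
by apply/funext => t; rewrite big_cons.
Qed.

(** The filter is left general so as to cover interior points and the one-sided limits at both
    endpoints. *)
Let Lam_cvg (F : set_system R) t : Filter F -> 0 <= t <= 1 ->
  (\forall u \near F, 0 <= u <= 1) ->
  (fun u => \sum_(i < n) TV i u) @ F --> (\sum_(i < n) TV i t) -> Lam @ F --> Lam t.
Proof.
move=> FF /andP[t0 t1] F01 /cvgrPdist_lt cF; apply/cvgrPdist_lt => e e0.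
have := cF e e0; move: F01; apply: filterS2 => u /andP[u0 u1]; apply: le_lt_trans.
have [tu|/ltW ut] := leP t u.
  rewrite distrC [leRHS]distrC !ger0_norm ?subr_ge0 ?Lam_mono ?Lam_le_TV//.
  rewrite -subr_ge0 (le_trans _ (Lam_le_TV t0 tu u1))// subr_ge0 Lam_mono//.
rewrite !ger0_norm ?subr_ge0 ?Lam_mono ?Lam_le_TV//.
rewrite -subr_ge0 (le_trans _ (Lam_le_TV u0 ut t1))// subr_ge0 Lam_mono//.
Qed.

Let Lam_continuous : {within `[0, 1], continuous Lam}.
Proof.
have /(continuous_within_itvP _ ltr01)[ci c0 c1] := TVsum_cont.
apply/(continuous_within_itvP _ ltr01); split.
- move=> t t01; apply: Lam_cvg; last exact: ci.
    by move: t01; rewrite in_itv/= => /andP[/ltW -> /ltW ->].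
  by near=> u; have : u \in `]0, 1[ by [near: u; exact: near_in_itvoo];
    rewrite in_itv/= => /andP[/ltW -> /ltW ->].
- apply: Lam_cvg c0; rewrite ?lexx ?ler01//.
  by near=> u; apply/andP; split; near: u; [exact: nbhs_right_ge|exact: nbhs_right_le].
- apply: Lam_cvg c1; rewrite ?lexx ?ler01//.
  by near=> u; apply/andP; split; near: u; [exact: nbhs_left_ge|exact: nbhs_left_le].
Unshelve. all: by end_near. Qed.

Let Lam0 : Lam 0 = 0.
Proof.
have : (len 0 0 <= 0)%E.
  apply: arc_length_le => s; case: s => [//|t s] /= /andP[t0 ps] ls.
  suff : t <= last t s by rewrite ls leNgt t0.
  elim: s t ps {t0 ls} => //= u s IH t /andP[/ltW tu /IH]; exact: le_trans.
by rewrite LamE ?lexx ?ler01// lee_fin => L0; apply/eqP; rewrite eq_le L0 fine_ge0// arc_length_ge0.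
Qed.

(** The length function is continuous and runs from 0 to [L], so by the intermediate value theorem
    some parameter has length [s]; the default value of [xget] is therefore never taken. *)
Let param_spec s : 0 <= s <= L ->
  exists t, [/\ 0 <= t <= 1, Lam t = s & arc_length_param gamma s = gamma t].
Proof.
move=> sL; rewrite /arc_length_param; set A := [set t | _].
have [t0 [t01 At0]] : exists t0, 0 <= t0 <= 1 /\ Lam t0 = s.
  have [|t t01 <-] := @IVT R Lam 0 1 s ler01 Lam_continuous.
    by rewrite Lam0 minEle maxEle (_ : 0 <= Lam 1)// fine_ge0// arc_length_ge0.
  by exists t; split => //; move: t01; rewrite in_itv.
have /xgetPex : exists t, A t by exists t0; split => //; rewrite LamE// At0.
move=> /(_ 0)[t1 At1]; exists (xget 0 A); split => //.
by rewrite /Lam At1.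
Qed.

Lemma arc_length_param_lipschitz s s' : 0 <= s <= L -> 0 <= s' <= L ->
  enorm (arc_length_param gamma s - arc_length_param gamma s') <= `|s - s'|.
Proof.
move=> /param_spec[t [/andP[t0 t1] <- ->]] /param_spec[t' [/andP[t'0 t'1] <- ->]].
have [tt'|/ltW tt'] := leP t t'.
  by rewrite enormB distrC (le_trans (enorm_le_Lam t0 tt' t'1))// ler_norm.
by rewrite (le_trans (enorm_le_Lam t'0 tt' t1))// ler_norm.
Qed.

Lemma arc_length_total_ge0 : 0 <= L.
Proof. by rewrite fine_ge0// arc_length_ge0. Qed.

Lemma arc_length_param0 : arc_length_param gamma 0 = x.
Proof.
have [|t [/andP[t0 t1] Lt ->]] := @param_spec 0; first by rewrite lexx arc_length_total_ge0.
have := enorm_le_Lam (lexx 0) t0 t1; rewrite Lt Lam0 subrr.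
have [_ <- _ _] := rect => H; apply/eqP; rewrite -subr_eq0 -enorm_eq0.
by rewrite eq_le H enorm_ge0.
Qed.

Lemma arc_length_param1 : arc_length_param gamma L = y.
Proof.
have [|t [/andP[t0 t1] Lt ->]] := @param_spec L; first by rewrite lexx arc_length_total_ge0.
have := enorm_le_Lam t0 t1 (lexx 1); rewrite Lt subrr.
have [_ _ <- _] := rect => H; apply/eqP; rewrite -subr_eq0 -enorm_eq0 enormB.
by rewrite eq_le H enorm_ge0.
Qed.

End arc_length_parametrization.

(** * Lower bound for the weighted length *)

Section lipschitz.
Context {R : realType}.
Variable rho : R -> R.
Hypothesis lip : forall s t, `|rho s - rho t| <= `|s - t|.

Lemma lipschitz1_measurable : measurable_fun [set: R] rho.
Proof.
apply: continuous_measurable_fun => s; apply/cvgrPdist_lt => e e0; near=> t.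
apply: (le_lt_trans (lip s t)).
by near: t; exact: cvgr_dist_lt.
Unshelve. all: by end_near. Qed.

(** On arbitrary sets [lebesgue_measure] is the outer measure. In a cover of [H] by intervals, each
    interval is mapped into an interval of the same length centered at the image of its midpoint. *)
Lemma lebesgue_measure_lipschitz_image (H : set R) :
  ((lebesgue_measure (rho @` H) : \bar R) <= lebesgue_measure H)%E.
Proof.
pose mu := @lebesgue_measure R.
rewrite -/(mu _) -/(mu H) [leRHS](outer_measure_open_itv_cover H).
apply: le_ereal_inf_tmp => _ [F [Fitv HF] <-].
have exJ k : exists J, rho @` F k `<=` J /\ mu J = wlength idfun (F k).
  have [[a b] -> ] := Fitv k; have [ab|ba] := ltP a b.
    pose m := rho ((a + b) / 2).
    exists `[m - (b - a) / 2, m + (b - a) / 2]%classic; split.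
      move=> _ [t /= + <-]; rewrite !in_itv/= => /andP[ta tb].
      have := lip t ((a + b) / 2); rewrite -/m => /le_trans mt.
      have : `|rho t - m| <= (b - a) / 2.
        by apply: mt; rewrite ler_norml; apply/andP; split; lra.
      by rewrite ler_norml => /andP[? ?]; apply/andP; split; lra.
    rewrite /mu lebesgue_measure_itv/= wlength_itv/= !lte_fin ab ifT; last lra.
    by rewrite -!EFinB; congr EFin; field.
  exists set0; split; last first.
    by rewrite set_itv_ge ?bnd_simp -?leNgt// wlength0; exact: (measure0 (@lebesgue_measure R)).
  by move=> _ [t /= + _]; rewrite in_itv/= => /andP[ta tb]; lra.
have [J HJ] := choice exJ.
apply: (@le_trans _ _ (mu (\bigcup_k J k))).
  apply: (@le_outer_measure _ _ mu) => _ [t Ht <-].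
  have [k _ Fk] := HF t Ht; exists k => //.
  by apply: (HJ k).1; exists t.
apply: (le_trans (outer_measure_sigma_subadditive mu J)).
apply: lee_nneseries => [k _ _|k _]; last by rewrite -(HJ k).2.
exact: (measure_ge0 (@lebesgue_measure R)).
Qed.

Variables (L r : R).
Hypotheses (L0 : 0 <= L) (rho0 : rho 0 = 0) (rhoL : rho L = r).

Lemma lipschitz_hitting_time : 0 <= r -> exists s : R -> R,
  nondecreasing_fun s /\ forall t, 0 <= t <= r -> 0 <= s t <= L /\ rho (s t) = t.
Proof.
(* Capping t at r keeps [L] in [A t] for every real t, so the infimum is nondecreasing on the whole
   line; monotonicity is what gives measurability, as hitting times may jump. *)
move=> r0; pose A t := [set u | 0 <= u <= L /\ Num.min t r <= rho u].
have AL t : A t L by split; rewrite ?L0 ?lexx// rhoL ge_min lexx orbT.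
have Alb t : has_lbound (A t) by exists 0 => u [/andP[]].
have Ainf t : has_inf (A t) by split => //; exists L.
have s0 t : 0 <= inf (A t) by apply: lb_le_inf => [|u [/andP[]]//]; exists L.
exists (fun t => inf (A t)); split.
  move=> t t' tt'; apply: lb_le_inf; first by exists L.
  move=> u [uL tu]; apply: ge_inf => //; split => //.
  by rewrite (le_trans _ tu)// le_min ge_min tt'/= ge_min lexx orbT.
move=> t /andP[t0 tr]; have tr' : Num.min t r = t by apply/min_idPl.
split; first by rewrite s0/= ge_inf.
apply/eqP; rewrite eq_le; apply/andP; split; rewrite leNgt; apply/negP => Ht.
(* If rho overshoots t at the infimum, stepping back by e still leaves rho at or above t; e <= s
   keeps the time nonnegative. *)
- set s := inf (A t) in Ht *; pose e := Num.min s (rho s - t).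
  have s1 : 0 < s.
    rewrite lt_def s0 andbT; apply/eqP => s1; move: Ht; rewrite s1 rho0; lra.
  have e0 : 0 < e by rewrite lt_min s1 subr_gt0.
  have es : e <= s by rewrite ge_min lexx.
  have et : e <= rho s - t by rewrite ge_min lexx orbT.
  have sL : s <= L by exact: ge_inf.
  have : A t (s - e).
    split; first by apply/andP; split; lra.
    rewrite tr'; have := lip s (s - e); rewrite subKr (gtr0_norm e0).
    by rewrite ler_norml => /andP[_]; lra.
  by move=> /(ge_inf (Alb t)); rewrite -/s; lra.
(* If rho falls short of t, it cannot reach t within a time smaller than the gap, although the
   infimum is approached by such times. *)
- set s := inf (A t) in Ht *.
  have e0 : 0 < t - rho s by rewrite subr_gt0.
  have [u [uL]] := inf_adherent e0 (Ainf t); rewrite tr' -/s => tu us.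
  have su : s <= u by apply: ge_inf => //; split => //; rewrite tr'.
  have := lip u s; rewrite (ger0_norm (_ : 0 <= u - s)) ?subr_ge0//.
  by rewrite ler_norml => /andP[_]; lra.
Qed.

End lipschitz.

Lemma measurable_fun_rV d (T : measurableType d) (R : realType) (n : nat) (f : T -> 'rV[R]_n) :
  (forall i, measurable_fun [set: T] (fun t => f t ord0 i)) -> measurable_fun [set: T] f.
Proof.
move=> mf _ A mA; rewrite setTI; move: A mA.
apply: (@smallest_sub _ (sigma_algebra setT) _ [set A | measurable (f @^-1` A)]).
  split => /=.
  - by rewrite preimage_set0.
  - by move=> B mB; rewrite setTD preimage_setC; exact: measurableC.
  - by move=> H mH; rewrite preimage_bigcup; exact: bigcupT_measurable.
move=> B; rewrite -bigcup_seq => -[i _] [D mD <-] /=; rewrite setTI.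
by rewrite -[X in measurable X]setTI; exact: (mf i measurableT D mD).
Qed.

(** * Potentials along a curve *)

Section curve.
Context {R : realType} {n : nat}.
Hypothesis n0 : (0 < n)%N.
Local Notation lambda := (lebesgue_rV R n).
Local Notation mu := (@lebesgue_measure R).

(** Since tau t lies on the sphere of radius t about x, its distance to z is at least |t - |z - x||.
    The kernel along [tau] thus has at worst a one-dimensional singularity, for any pole z and any
    such [tau], which need only be measurable. *)
Lemma integral_gauge_pot_transversal_le p : L1_locally_bounded p -> (forall z, 0 <= p z) ->
  exists2 K : R, 0 <= K & forall (x : 'rV[R]_n) (r : R) (tau : R -> 'rV[R]_n), 0 < r ->
    measurable_fun [set: measurableTypeR R] tau ->
    (forall t, 0 <= t <= r -> enorm (tau t - x) = t) ->
    measurable_fun (`[0, r]%classic : set (measurableTypeR R))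
      (fun t => gauge_pot p x r (tau t)) /\
    (\int[mu]_(t in `[0%R, r]) gauge_pot p x r (tau t) <= (K * r)%:E)%E.
Proof.
move=> Pp p0; have mp := L1_measurable Pp.
have a0 : 0 < (2^-1 : R) < 1%:R by rewrite invr_gt0 ltr0n/= invf_lt1// ltr1n.
have [T T0 HT] := integral_kernel_le a0 (ler0n R 2) (@ltr01 R).
exists (6 * (T + 1) * \int[lambda]_z p z).
  by rewrite mulr_ge0 ?Rintegral_ge0// mulr_ge0// addr_ge0.
move=> x r tau r0 mtau taux; rewrite mulrAC.
have xr t : `[0, r]%classic t -> eball x r (tau t).
  by rewrite /= in_itv/= => tr; rewrite /eball/= taux//; case/andP: tr.
have mk : measurable_fun [set: measurableTypeR R * 'rV[R]_n]
    (fun tz => logker x r (tau tz.1) tz.2).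
  apply: (measurableT_comp (measurable_logker x r) (g := fun tz => (tau tz.1, tz.2))).
  apply: measurable_fun_pair => //.
  exact: (measurableT_comp mtau measurable_fst).
have k0 t z : `[0, r]%classic t -> 0 <= logker x r (tau t) z.
  by move=> /xr; exact: logker_ge0.
split.
  have := @measurable_fun_weighted_integral R _ _ _ _ lambda _
    (fun tz => logker x r (tau tz.1) tz.2) p (measurable_itv `[0, r]) mk k0 p0 mp.
  by rewrite /gauge_pot.
apply: (@integral_kernel_mass_le R _ _ _ _ mu lambda _
    (fun tz => logker x r (tau tz.1) tz.2) p (measurable_itv _) mk k0 p0 mp).
- by rewrite mulr_ge0 ?(ltW r0)// mulr_ge0// addr_ge0.
- move=> z.
  (* Equal to [enorm (tau t - z)] on [0, r]; the second argument of the maximum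
     gives sublevel sets of measure at most [2 * s] without restricting t. *)
  pose d t := Num.max (enorm (tau t - z)) `|t - enorm (z - x)|.
  have md : measurable_fun [set: measurableTypeR R] d.
    apply: measurable_maxr.
      exact: (measurableT_comp (measurable_enormB1 z) mtau).
    by apply: measurableT_comp => //; exact: measurable_funB.
  have dE t : `[0, r]%classic t -> d t = enorm (tau t - z).
    rewrite /= in_itv/= => /taux tx; apply/max_idPl; rewrite -{1}tx.
    by rewrite (le_trans (enorm_rev_triangle _ _))// opprB addrA subrK.
  have mh : measurable_fun [set: measurableTypeR R]
      (fun t => Num.max 1 (r / d t) `^ 2^-1).
    apply: (measurableT_comp (f := fun u => u `^ 2^-1)); first exact: measurable_powR.
    apply: measurable_maxr => //; apply: measurable_funM => //.
    exact: (measurableT_comp (@measurable_inv R)).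
  apply: (@le_trans _ _ (\int[mu]_(t in `[0%R, r])
      (6%:E * (Num.max 1 (r / d t) `^ 2^-1)%:E))%E).
    apply: ge0_le_integral => //.
    + by move=> t tr; rewrite lee_fin; exact: k0.
    + apply/measurable_EFinP/measurable_funTS.
      exact: (measurableT_comp mk (measurable_pair2 z)).
    + by apply/measurable_EFinP/measurable_funTS; exact: measurable_funM.
    + move=> t tr; rewrite -EFinM lee_fin dE//.
      have [H1 H2] := logker_triangle z (xr t tr).
      exact: (ln_ratio_le_pow r0 (enorm_ge0 _) (enorm_ge0 _) H1 H2).
  rewrite ge0_integralZl//; last 2 first.
  - by apply/measurable_EFinP; exact: measurable_funTS.
  - by move=> t _; rewrite lee_fin powR_ge0.
  rewrite -mulrA EFinM; apply: lee_wpmul2l => //.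
  apply: (le_trans (HT _ _ mu d r _ md r0 _ _)) => //.
    move=> s s0; rewrite expr1.
    apply: (@le_trans _ _ (mu `[enorm (z - x) - s, enorm (z - x) + s]%classic)).
      apply: le_measure; rewrite ?inE//; first exact: measurable_sublevel.
      move=> t /=; rewrite ge_max => /andP[_]; rewrite in_itv/= ler_norml => /andP[? ?].
      by apply/andP; split; lra.
    rewrite lebesgue_measure_itv/= lte_fin ifT; last lra.
    by rewrite -EFinB lee_fin; lra.
  have mur : mu `[0, r]%classic = r%:E.
    by rewrite lebesgue_measure_itv/= lte_fin r0 -EFinB subr0.
  by rewrite [X in (T%:E * X)%E](_ : _ = r%:E)// expr1 -EFinM -EFinD mulrDl.
- by rewrite integral_fine.
Qed.

(** A set of levels of measure at least r / 2 on which V <= 2 K + 1 is carried back to the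
    arc-length variable: the distance to x is 1-Lipschitz in arc length, so the arc lengths that
    produce these levels also have measure at least r / 2. On them exp w is at least exp (A - (2 K +
    1)). *)
Lemma weighted_length_ge p : L1_locally_bounded p -> (forall z, 0 <= p z) ->
  exists2 kappa : R, 0 < kappa & forall gamma (x y : 'rV[R]_n) (w : 'rV[R]_n -> R) (A : R),
    x != y -> rectifiable_arc gamma x y -> measurable_fun setT w ->
    (forall xi, eball x (enorm (y - x)) xi ->
      A - fine (gauge_pot p x (enorm (y - x)) xi) <= w xi) ->
    ((kappa * expR A * enorm (y - x))%:E <=
      weighted_length (fun xi => expR (n%:R * w xi)) gamma)%E.
Proof.
move=> Pp p0; have [K K0 HK] := integral_gauge_pot_transversal_le Pp p0.
exists (expR (- (2 * K + 1)) / 2); first by rewrite divr_gt0// expR_gt0.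
move=> gamma x y w A xy rect mw; set r := enorm (y - x) => wA.
have r0 : 0 < r by rewrite enorm_gt0 subr_eq0 eq_sym.
rewrite /weighted_length; set L := fine _; set sg := arc_length_param gamma.
have L0 : 0 <= L by exact: arc_length_total_ge0.
(* Clamping to [0, L] extends the parametrization to the whole line with the same Lipschitz
   constant. *)
pose cl (s : R) := Num.max 0 (Num.min s L).
have clL s : 0 <= cl s <= L.
  by rewrite /cl le_max lexx/= ge_max L0 ge_min lexx orbT.
have clE s : 0 <= s <= L -> cl s = s.
  by move=> /andP[s0 sL]; rewrite /cl (min_idPl sL); apply/max_idPr.
have cllip s t : `|cl s - cl t| <= `|s - t|.
  rewrite /cl; case: (leP s L) => sL; case: (leP t L) => tL.
  - case: (leP 0 s) => s0; case: (leP 0 t) => t0//; rewrite ?subrr ?normr0// ?subr0 ?sub0r ?normrN;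
      rewrite ler_norml; have := ler_norm (s - t); have := ler_norm (t - s); rewrite (distrC t s); 
      try (rewrite (ger0_norm s0)); try (rewrite (ger0_norm t0)); lra.
  - rewrite (max_idPr L0); case: (leP 0 s) => s0; rewrite ler_norml;
      have := ler_norm (t - s); rewrite (distrC t s); lra.
  - rewrite (max_idPr L0); case: (leP 0 t) => t0; rewrite ler_norml;
      have := ler_norm (s - t); lra.
  - by rewrite subrr normr0.
pose sc s := sg (cl s).
have sclip s t : enorm (sc s - sc t) <= `|s - t|.
  by apply: le_trans (cllip s t); exact: (arc_length_param_lipschitz rect).
pose rho s := enorm (sc s - x).
have rholip s t : `|rho s - rho t| <= `|s - t|.
  apply: le_trans (sclip s t); apply: (le_trans (enorm_rev_triangle _ _)).
  by rewrite opprB addrA subrK.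
have rho0 : rho 0 = 0.
  by rewrite /rho /sc clE ?lexx// /sg (arc_length_param0 rect) subrr enorm0.
have rhoL : rho L = r.
  by rewrite /rho /sc clE ?lexx ?L0// /sg (arc_length_param1 rect).
have msc : measurable_fun [set: measurableTypeR R] sc.
  apply: measurable_fun_rV => i; apply: lipschitz1_measurable => s t.
  apply: le_trans (sclip s t).
  by have := coord_le_enorm (sc s - sc t) i; rewrite !mxE.
have [s [snd shit]] := lipschitz_hitting_time rholip L0 rho0 rhoL (ltW r0).
have mtau : measurable_fun [set: measurableTypeR R] (sc \o s).
  by apply: measurableT_comp => //; exact: nondecreasing_measurable.
have [mV VK] := HK x r (sc \o s) r0 mtau (fun t tr => (shit t tr).2).
have mur : mu `[0, r]%classic = r%:E.
  by rewrite lebesgue_measure_itv/= lte_fin r0 -EFinB subr0.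
have V0 t : `[0, r]%classic t -> (0 <= gauge_pot p x r (sc (s t)))%E.
  rewrite /= in_itv/= => tr; apply: integral_ge0 => z _; rewrite lee_fin mulr_ge0//.
  by rewrite logker_ge0// /eball/= -/(rho _) (shit t tr).2; case/andP: tr.
have := @half_measure_sublevel R _ _ mu `[0, r]%classic
  (fun t => gauge_pot p x r (sc (s t))) r K (measurable_itv `[0, r]) mur K0 mV V0 VK.
set G := _ `&` _ => HG.
have mB := @measurable_eball R n x r.
have mg := measurable_gauge_pot r0 mB (@subset_refl _ _) Pp p0.
pose U := eball x r `&` [set xi | (gauge_pot p x r xi <= (2 * K + 1)%:E)%E].
have mU : measurable U by exact: emeasurable_fun_infty_c.
(* All arc lengths whose point is good, and not only the hitting times: this set is measurable, and
   its image under [rho] contains the good levels. *)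
pose H : set (measurableTypeR R) := `[0, L]%classic `&` sc @^-1` U.
have mH : measurable H.
  apply: measurableI; first exact: measurable_itv.
  by have := msc measurableT U mU; rewrite setTI.
have GH : G `<=` rho @` H.
  move=> t [/= tr Vt]; have tr' : 0 <= t <= r by move: tr; rewrite in_itv.
  have [sL st] := shit t tr'; exists (s t) => //; split => /=; first by rewrite in_itv.
  by split => //; rewrite /eball/= -/(rho _) st; case/andP: tr'.
have HH : ((r / 2)%:E <= mu H)%E.
  apply: (le_trans HG); apply: le_trans (lebesgue_measure_lipschitz_image rholip H).
  exact: (@le_outer_measure _ _ mu).
have powE xi : expR (n%:R * w xi) `^ n%:R^-1 = expR (w xi).
  by rewrite /powR gt_eqF ?expR_gt0// expRK mulrA mulVf ?mul1r// pnatr_eq0 -lt0n.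
rewrite [leRHS](_ : _ = \int[mu]_(u in `[0%R, L]) (expR (w (sc u)))%:E)%E; last first.
  apply: eq_integral => u; rewrite inE/= in_itv/= => uL.
  by rewrite powE /sc clE.
have mf : measurable_fun [set: measurableTypeR R] (fun u => (expR (w (sc u)))%:E).
  apply/measurable_EFinP; apply: measurableT_comp => //.
  exact: (measurableT_comp mw msc).
apply: (@le_trans _ _ (\int[mu]_(u in H) (expR (A - (2 * K + 1)))%:E)%E).
  rewrite integral_cst//= expRD.
  rewrite (_ : _ * r = expR A * expR (- (2 * K + 1)) * (r / 2)); last by ring.
  by rewrite EFinM; apply: lee_wpmul2l => //; rewrite lee_fin mulr_ge0// expR_ge0.
apply: (@le_trans _ _ (\int[mu]_(u in H) (expR (w (sc u)))%:E)%E).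
  apply: ge0_le_integral => //; first exact: measurable_funTS.
  move=> u [_ [ux uK]]; rewrite lee_fin ler_expR; apply: le_trans (wA _ ux).
  by rewrite lerB// -lee_fin fineK//; exact: gauge_pot_fin_num.
apply: ge0_subset_integral => //; first exact: measurable_funTS.
by move=> u [].
Qed.

End curve.

(** * Strong A-infinity property *)

(** Tonelli's theorem applies to the positive and the negative part separately, and [fine] is
    measurable. *)
Lemma measurable_fun_Rintegral d1 d2 (X : measurableType d1) (Y : measurableType d2)
    (R : realType) (m2 : {sigma_finite_measure set Y -> \bar R}) (f : X * Y -> R) :
  measurable_fun setT f -> measurable_fun setT (fun x => \int[m2]_y f (x, y)).
Proof.
move=> mf; have mF : measurable_fun setT (EFin \o f) by exact/measurable_EFinP.
apply: (measurableT_comp (f := @fine R)); first exact: fine_measurable.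
under eq_fun do rewrite integralE.
apply: emeasurable_funB.
  have H : measurable_fun setT (fubini_F m2 ((EFin \o f)^\+)%E).
    by apply: measurable_fun_fubini_tonelli_F => //; exact: measurable_funepos.
  apply: (eq_measurable_fun (fubini_F m2 ((EFin \o f)^\+)%E)) => // x _.
  by apply: eq_integral => y _; rewrite !funeposE.
have H : measurable_fun setT (fubini_F m2 ((EFin \o f)^\-)%E).
  by apply: measurable_fun_fubini_tonelli_F => //; exact: measurable_funeneg.
apply: (eq_measurable_fun (fubini_F m2 ((EFin \o f)^\-)%E)) => // x _.
by apply: eq_integral => y _; rewrite !funenegE.
Qed.

(* [ge0_subset_integral] without any measurability. *)
Lemma ge0_subset_integral_nonmeasurable d (T : measurableType d) (R : realType)
    (mu : {measure set T -> \bar R}) (A B : set T) (f : T -> \bar R) :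
  A `<=` B -> (forall x, 0 <= f x)%E ->
  (\int[mu]_(x in A) f x <= \int[mu]_(x in B) f x)%E.
Proof.
move=> AB f0; rewrite (integral_mkcond A) (integral_mkcond B).
have p0 D x : (0 <= (f \_ D) x)%E by rewrite patchE; case: ifPn.
rewrite !ge0_integralTE//; apply: ereal_sup_le => _ [h hf <-].
exists h => // x; apply: (le_trans (hf x)).
rewrite !patchE; case: ifPn => [/set_mem/AB/mem_set ->//|_].
by have := p0 B x; rewrite patchE.
Qed.

Section main.
Context {R : realType} {n : nat}.
Local Notation lambda := (lebesgue_rV R n).

Lemma continuous_L1_locally_bounded (P : 'rV[R]_n -> R) : continuous P ->
  lambda.-integrable setT (EFin \o P) -> L1_locally_bounded P.
Proof.
move=> cP IP; split=> // rho; have [rho0|rho0] := leP 0 rho; last first.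
  by exists 0 => // z; have := enorm_ge0 z; lra.
pose A := [set v : 'rV[R]_n | forall i, `[- rho, rho]%classic (v ord0 i)].
have cA : compact A by apply: (@rV_compact R n (fun=> `[- rho, rho]%classic)) => i; exact: segment_compact.
have A0 : A !=set0.
  by exists 0 => i /=; rewrite mxE in_itv/= oppr_le0 rho0.
have cN : {within A, continuous (fun z => `|P z|)}.
  by apply: continuous_subspaceT => z; apply: (continuous_comp (cP z)); exact: norm_continuous.
have [v _ Hv] := EVT_max_rV A0 cA cN.
exists `|P v| => // z zr; apply: Hv; rewrite inE => i /=.
have := le_trans (coord_le_enorm z i) zr.
by rewrite in_itv/= ler_norml.
Qed.

Hypothesis n0 : (0 < n)%N.

Lemma compact_sub_eball (K : set 'rV[R]_n) : compact K ->
  exists2 r : R, 0 < r & K `<=` eball 0 r.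
Proof.
move=> /compact_bounded[M [_ HM]]; pose m := `|M| + 1.
have m0 : 0 < m by rewrite ltr_wpDl.
exists (n%:R * m); first by rewrite mulr_gt0// ltr0n.
move=> x Kx; rewrite /eball/= subr0; apply: enorm_le_cube => i.
have Mm : M < m by rewrite (le_lt_trans (ler_norm M))// ltrDl.
apply: le_trans (HM m Mm x Kx).
rewrite [leRHS]mx_normrE.
exact: (le_bigmax _ (fun ij : 'I_1 * 'I_n => `|x ij.1 ij.2|) (ord0, i)).
Qed.

Lemma strong_A_infinity_of_gauge_bounds (w pp pn : 'rV[R]_n -> R) (K : R) :
  measurable_fun setT w -> L1_locally_bounded pp -> L1_locally_bounded pn ->
  (forall z, 0 <= pp z) -> (forall z, 0 <= pn z) -> \int[lambda]_z pp z < 1 ->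
  (forall o r, 0 < r -> exists A : R, forall x, eball o r x ->
    [/\ gauge_pot pp o r x \is a fin_num, gauge_pot pn o r x \is a fin_num &
        `|w x - (A + (fine (gauge_pot pp o r x) - fine (gauge_pot pn o r x)))| <= K]) ->
  strong_A_infinity_weight (fun x => expR (n%:R * w x)).
Proof.
move=> mw Ppp Ppn pp0 pn0 pp1 HA; set om := fun x => _.
have n1 : 0 < n%:R :> R by rewrite ltr0n.
have mom : measurable_fun setT (EFin \o om).
  by apply/measurable_EFinP; apply: measurableT_comp => //; exact: measurable_funM.
have om0 x : 0 < om x by exact: expR_gt0.
(* Both potentials are nonnegative on the ball, so each inequality may drop one of them. *)
have bounds o r : 0 < r -> exists A : R, forall x, eball o r x ->
    w x <= A + K + fine (gauge_pot pp o r x) /\ A - K - fine (gauge_pot pn o r x) <= w x.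
  move=> r0; have [A HAx] := HA o r r0; exists A => x xr; have [_ _] := HAx x xr.
  have u0 : 0 <= fine (gauge_pot pp o r x).
    by apply: fine_ge0; apply: integral_ge0 => z _; rewrite lee_fin mulr_ge0// logker_ge0.
  have v0 : 0 <= fine (gauge_pot pn o r x).
    by apply: fine_ge0; apply: integral_ge0 => z _; rewrite lee_fin mulr_ge0// logker_ge0.
  by rewrite ler_norml => /andP[? ?]; split; lra.
(* Used with small [eta] for the A-infinity property, and with [eta] equal to 1 for local
   integrability and for the quasidistance. *)
have upper eta : 0 < eta -> exists2 T : R, 0 <= T & forall o r A E, 0 < r -> measurable E ->
    E `<=` eball o r ->
    (forall x, eball o r x -> w x <= A + K + fine (gauge_pot pp o r x)) ->
    (weighted_measure om E <=
      (expR (n%:R * (A + K)))%:E * (T%:E * lambda E + (eta * r ^+ n)%:E))%E.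
  move=> eta0; have [T T0 HT] := integral_expR_gauge_pot_le n0 Ppp pp0 pp1 eta0.
  exists T => // o r A E r0 mE Er wA.
  have mg := measurable_gauge_pot r0 mE Er Ppp pp0.
  have mf : measurable_fun E (fun x => (expR (n%:R * fine (gauge_pot pp o r x)))%:E).
    apply/measurable_EFinP; apply: measurableT_comp => //; apply: measurable_funM => //.
    by apply: (measurableT_comp (f := @fine R)) => //; exact: fine_measurable.
  apply: (@le_trans _ _ (\int[lambda]_(x in E)
      ((expR (n%:R * (A + K)))%:E * (expR (n%:R * fine (gauge_pot pp o r x)))%:E))%E).
    apply: ge0_le_integral => //.
    - by move=> x _; rewrite lee_fin ltW.
    - exact: measurable_funTS.
    - exact: measurable_funeM.
    - move=> x Ex; rewrite -EFinM lee_fin -expRD ler_expR -mulrDr ler_pM2l// wA//.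
      exact: Er.
  rewrite ge0_integralZl//.
  by apply: lee_wpmul2l; [rewrite lee_fin expR_ge0|exact: HT].
split.
  split => //.
    move=> C cC; have [r r0 Cr] := compact_sub_eball cC.
    apply/integrableP; split; first exact: measurable_funS mom.
    have [A HAx] := bounds 0 r r0.
    have [T T0 HT] := upper 1 ltr01.
    have mB := @measurable_eball R n 0 r.
    apply: (@le_lt_trans _ _ (weighted_measure om (eball 0 r))).
      apply: (le_trans (ge0_subset_integral_nonmeasurable _ Cr _)) => [x|]; first exact: abse_ge0.
      rewrite le_eqVlt; apply/orP; left; apply/eqP; apply: eq_integral => x _ /=.
      by rewrite ger0_norm// ltW.
    apply: (le_lt_trans (HT 0 r A _ r0 mB (@subset_refl _ _) (fun x xr => (HAx x xr).1))).
    apply: lte_mul_pinfty => //.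
    apply: lte_add_pinfty; last exact: ltry.
    apply: lte_mul_pinfty; rewrite ?lee_fin//.
    by apply: le_lt_trans (lebesgue_rV_eball_le _ (ltW r0)) _; rewrite ltry.
  move=> eps eps0.
  have [kappa kappa0 Hkappa] := integral_cube_expRN_gauge_pot_ge n0 Ppn pn0.
  (* Chosen so that exp (n (A + K)) * b = eps * kappa * exp (n (A - K)), whatever [A] is. One half
     of b pays for the term in [eta], where the ball radius n l contributes n^n, the other half for
     T times delta; T + 1 avoids dividing by 0. *)
  pose b := eps * kappa / expR (2 * n%:R * K).
  have b0 : 0 < b by rewrite divr_gt0 ?expR_gt0// mulr_gt0.
  have N0 : 0 < n%:R ^+ n :> R by rewrite exprn_gt0.
  pose eta := b / 2 / n%:R ^+ n.
  have eta0 : 0 < eta by rewrite divr_gt0// divr_gt0.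
  have [T T0 HT] := upper eta eta0.
  have T1 : 0 < T + 1 by rewrite ltr_wpDl.
  exists (b / 2 / (T + 1)); first by rewrite divr_gt0// divr_gt0.
  move=> a l E l0 mE El; rewrite lebesgue_rV_cube; last exact: ltW.
  move=> lE; have r0 : 0 < n%:R * l by rewrite mulr_gt0.
  have [A HAx] := bounds a (n%:R * l) r0.
  have Qr := @cube_sub_eball R n a l.
  have mQ := @measurable_cube R n a l.
  have ln0 : 0 < l ^+ n by rewrite exprn_gt0.
  apply: (le_trans (HT a _ A E r0 mE (subset_trans El Qr) (fun x xr => (HAx x xr).1))).
  have lower : ((expR (n%:R * (A - K)) * (kappa * l ^+ n))%:E <= weighted_measure om (cube a l))%E.
    have mg := measurable_gauge_pot r0 mQ Qr Ppn pn0.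
    have mf : measurable_fun (cube a l)
        (fun x => (expR (- (n%:R * fine (gauge_pot pn a (n%:R * l) x))))%:E).
      apply/measurable_EFinP; apply: measurableT_comp => //; apply: measurable_funN.
      apply: measurable_funM => //.
      by apply: (measurableT_comp (f := @fine R)) => //; exact: fine_measurable.
    apply: (@le_trans _ _ (\int[lambda]_(x in cube a l) ((expR (n%:R * (A - K)))%:E *
        (expR (- (n%:R * fine (gauge_pot pn a (n%:R * l) x))))%:E))%E).
      rewrite ge0_integralZl//.
      by rewrite EFinM; apply: lee_wpmul2l; [rewrite lee_fin expR_ge0|exact: Hkappa].
    apply: ge0_le_integral => //.
    - exact: measurable_funeM.
    - exact: measurable_funTS.
    - move=> x /Qr xr; rewrite -EFinM lee_fin -expRD ler_expR -mulrBr ler_pM2l//.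
      exact: (HAx x xr).2.
  apply: (@le_trans _ _ (eps%:E * (expR (n%:R * (A - K)) * (kappa * l ^+ n))%:E)%E); last first.
    by apply: lee_wpmul2l => //; rewrite lee_fin ltW.
  apply: (@le_trans _ _ (expR (n%:R * (A + K)) *
      (T * (b / 2 / (T + 1) * l ^+ n) + eta * (n%:R * l) ^+ n))%:E).
    rewrite [leRHS]EFinM; apply: lee_wpmul2l; first by rewrite lee_fin expR_ge0.
    rewrite EFinD leeD2r// [leRHS]EFinM.
    by apply: lee_wpmul2l; rewrite ?lee_fin// EFinM.
  rewrite -EFinM lee_fin.
  have E1 : expR (n%:R * (A + K)) = expR (n%:R * (A - K)) * expR (2 * n%:R * K).
    by rewrite -expRD; congr expR; ring.
  have e0 := expR_gt0 (2 * n%:R * K).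
  have -> : eps * (expR (n%:R * (A - K)) * (kappa * l ^+ n)) =
      expR (n%:R * (A + K)) * (b * l ^+ n).
    by rewrite E1 /b; field; rewrite gt_eqF.
  rewrite ler_pM2l ?expR_gt0// exprMn.
  have -> : eta * (n%:R ^+ n * l ^+ n) = b / 2 * l ^+ n.
    by rewrite /eta; field; rewrite gt_eqF.
  rewrite mulrA -mulrDl ler_pM2r//.
  have : T * (b / 2 / (T + 1)) <= b / 2.
    rewrite mulrA ler_pdivrMr// mulrDr mulr1 (mulrC T) lerDl; lra.
  lra.
have [T T0 HT] := upper 1 ltr01.
have [kappa kappa0 Hkappa] := weighted_length_ge n0 Ppn pn0.
(* T |B| + r^n <= M r^n for the ball B of diameter r = |x - y|, whose measure is bounded by that of
   the ball of radius r. *)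
pose M := T * 2 ^+ n + 1.
have M0 : 0 < M by rewrite ltr_wpDl// mulr_ge0// exprn_ge0.
have Mp : 0 < M `^ n%:R^-1 by rewrite powR_gt0.
exists (M `^ n%:R^-1 * expR (2 * K) / kappa).
  by rewrite divr_gt0// mulr_gt0// expR_gt0.
set C := _ / kappa; have C0 : 0 < C by rewrite divr_gt0// mulr_gt0// expR_gt0.
move=> x y.
have wl0 gamma : (0 <= weighted_length om gamma)%E.
  by apply: integral_ge0 => s _; rewrite lee_fin powR_ge0.
have d0 : (0 <= weighted_distance om x y)%E.
  by apply: le_ereal_inf_tmp => _ [gamma _ <-].
have mD : measurable (diametral_ball x y).
  exact: (@measurable_eball R n (2^-1 *: (x + y)) (enorm (x - y) / 2)).
(* For x = y there is no ball of positive radius to work on; the diametral ball is then a null set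
   and the left-hand side vanishes. *)
have [xy|xy] := eqVneq x y.
  rewrite /ball_quasidistance (_ : weighted_measure _ _ = 0%E).
    rewrite poweR0r ?invr_eq0 ?pnatr_eq0 -?lt0n//.
    by rewrite mule_ge0// lee_fin ltW.
  apply: null_set_integral => //; first exact: measurable_funTS.
  apply/eqP; rewrite eq_le measure_ge0 andbT.
  have e0 : enorm (x - y) / 2 = 0 by rewrite xy subrr enorm0 mul0r.
  have := @lebesgue_rV_eball_le R n (2^-1 *: (x + y)) (enorm (x - y) / 2).
  by rewrite {1 3}e0 mulr0 expr0n gtn_eqF//; apply.
set r := enorm (y - x).
have r0 : 0 < r by rewrite enorm_gt0 subr_eq0 eq_sym.
have [A HAx] := bounds x r r0.
(* The ball is centered at [x], and not at the midpoint, so that the same constant [A] serves for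
   the levels of the distance to [x] along curves. *)
have Dr : diametral_ball x y `<=` eball x r.
  move=> z; rewrite /diametral_ball/= /eball/= enormB -/r => zr.
  rewrite (le_trans (enorm_triangle (2^-1 *: (x + y)) z x))//.
  have -> : 2^-1 *: (x + y) - x = 2^-1 *: (y - x).
    by apply/rowP => i; rewrite !mxE; field.
  by rewrite enormZ -/r ger0_norm ?invr_ge0//; lra.
have pos_in (z : \bar R) : (0 <= z)%E -> z \in `[0%E, +oo%E].
  by move=> z0; rewrite in_itv/= z0 leey.
have quasi : (ball_quasidistance om x y <= (M `^ n%:R^-1 * expR (A + K) * r)%:E)%E.
  have -> : M `^ n%:R^-1 * expR (A + K) * r =
      (expR (n%:R * (A + K)) * (M * r ^+ n)) `^ n%:R^-1.
    rewrite powRM ?expR_ge0//; last by rewrite mulr_ge0// ?exprn_ge0// ltW.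
    rewrite powRM ?exprn_ge0//; [|exact: ltW|exact: ltW].
    rewrite -powR_mulrn ?(ltW r0)// -powRrM mulfV ?pnatr_eq0 -?lt0n// powRr1 ?(ltW r0)//.
    rewrite {2}/powR gt_eqF ?expR_gt0// expRK (mulrA n%:R^-1) mulVf ?pnatr_eq0 -?lt0n// mul1r.
    ring.
  rewrite -poweR_EFin /ball_quasidistance; apply: gt0_ler_poweR.
  - by rewrite invr_ge0 ltW.
  - by apply: pos_in; apply: integral_ge0 => z _; rewrite lee_fin ltW.
  - by apply: pos_in; rewrite lee_fin mulr_ge0 ?expR_ge0// mulr_ge0 ?exprn_ge0// ltW.
  apply: (le_trans (HT x r A _ r0 mD Dr (fun z zr => (HAx z zr).1))).
  rewrite [leRHS]EFinM; apply: lee_wpmul2l; first by rewrite lee_fin expR_ge0.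
  rewrite /M mulrDl [leRHS]EFinD leeD2r// -mulrA [leRHS]EFinM; apply: lee_wpmul2l; rewrite ?lee_fin//.
  rewrite -exprMn; apply: le_trans (lebesgue_rV_eball_le x (ltW r0)).
  by apply: le_measure; rewrite ?inE//; exact: measurable_eball.
apply: (le_trans quasi).
apply: (@le_trans _ _ (C%:E * (kappa * expR (A - K) * r)%:E)%E).
  rewrite -EFinM lee_fin le_eqVlt; apply/orP; left; apply/eqP.
  have -> : expR (A + K) = expR (2 * K) * expR (A - K) by rewrite -expRD; congr expR; ring.
  by rewrite /C; field; rewrite gt_eqF.
apply: lee_wpmul2l; first by rewrite lee_fin ltW.
apply: le_ereal_inf_tmp => _ [gamma gxy <-].
by apply: (Hkappa gamma x y w (A - K)) => // z zr; exact: (HAx z zr).2.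
Qed.

End main.

Unset Implicit Arguments.

Theorem corollary1p7 (R : realType) (n : nat) (n_ge2 : (2 <= n)%N)
    (n_even : ~~ odd n)
    (c : R) (c_fund : log_fundamental_constant n c)
    (P : 'rV[R]_n -> R) (P_cont : continuous P)
    (P_L1 : (lebesgue_rV R n).-integrable setT (EFin \o P))
    (P_lt : (\int[lebesgue_rV R n]_x (P x)%:E < c%:E)%E)
    (C : R) (w : 'rV[R]_n -> R)
    (w_def : forall x, w x = 1 / c *
       (\int[lebesgue_rV R n]_y (ln (enorm y / enorm (x - y)) * P y)) + C) :
  strong_A_infinity_weight (fun x => expR (n%:R * w x)).
Proof.
have n0 : (0 < n)%N by exact: ltn_trans n_ge2.
have [c0 _] := c_fund.
have HP := continuous_L1_locally_bounded P_cont P_L1.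
have mP := L1_measurable HP.
have Pc : \int[lebesgue_rV R n]_z P z < c.
  by rewrite -lte_fin -integral_fine.
have [pp [pn [K [[Ppp Ppn] [pp0 pn0] pp1 HA]]]] := potential_decomposition n0 c0 HP Pc w_def.
apply: strong_A_infinity_of_gauge_bounds HA => //.
rewrite (_ : w = fun x => 1 / c *
  (\int[lebesgue_rV R n]_y (ln (enorm y / enorm (x - y)) * P y)) + C); last exact/funext.
apply: measurable_funD => //; apply: measurable_funM => //.
suff mf : measurable_fun setT (fun xy : 'rV[R]_n * 'rV[R]_n =>
    ln (enorm xy.2 / enorm (xy.1 - xy.2)) * P xy.2).
  exact: (measurable_fun_Rintegral (lebesgue_rV R n) mf).
apply: measurable_funM; last exact: (measurableT_comp mP measurable_snd).
apply: (measurableT_comp (@measurable_ln R)); apply: measurable_funM.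
  have := @measurable_enormB1 R n 0; under eq_fun do rewrite subr0.
  by move=> me; exact: (measurableT_comp me measurable_snd).
exact: (measurableT_comp (@measurable_inv R) measurable_enormB).
Qed.
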